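(* Let $\mathcal{O}$ be a bigraded operad, horizontally bounded on the right, with a derived $A_\infty$-multiplication $\{m_{ij}\}$. Let $\{M_{ij}\}$ be the induced derived $A_\infty$-algebra structure on $S\mathfrak{s}\mathcal{O}$, let $\{\overline{M}_{ij}\}$ be the derived $A_\infty$-algebra structure on $S\mathfrak{s}\mathrm{End}_{S\mathfrak{s}\mathcal{O}}$ induced by it, and let $\Phi:S\mathfrak{s}\mathcal{O}\to S\mathfrak{s}\mathrm{End}_{S\mathfrak{s}\mathcal{O}}$ be the map $\Phi(Sx)=S\,\overline\sigma(\Phi'(x))$ induced by the braces, $\Phi'(x)=\sum_{n\ge0}b_n(x;-)$ (all defined in the context). Then $\Phi$ is a morphism of derived $A_\infty$-algebras, i.e. for all $i\ge0$ and $j\ge1$ $$\Phi\circ M_{ij}=\overline{M}_{ij}\circ\Phi^{\otimes j}.$$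
   Context: $R$ is a commutative ring. Bigraded $R$-modules $A=\{A^j_i\}$ are $(\mathbb{Z},\mathbb{Z})$-graded, $A_i^j$ having bidegree $(i,j)$ = (horizontal, vertical); $\langle x,y\rangle=x_1y_1+x_2y_2$ for bidegrees $(x_1,x_2),(y_1,y_2)$. Koszul rule: $(f\otimes g)(x\otimes z)=(-1)^{\langle g,x\rangle}f(x)\otimes g(z)$. Operads are non-symmetric; a bigraded operad is an operad in bigraded $R$-modules; $\mathrm{End}_A(n)$ is the bigraded module of maps $A^{\otimes n}\to A$. Horizontally bounded on the right: all components of horizontal degree greater than some fixed integer vanish. $S$ is the vertical shift, $S:A\to SA$ of bidegree $(0,1)$ being the identity. Derived $A_\infty$-algebra: a bigraded module $A$ with maps $m_{ij}:A^{\otimes j}\to A$ of bidegree $(i,2-(i+j))$, $i\ge0,j\ge1$, such that for all $u\ge0,v\ge1$: $\sum_{u=i+p,\,v=j+q-1,\,j=r+1+t}(-1)^{rq+t+pj}m_{ij}(1^{\otimes r}\otimes m_{pq}\otimes1^{\otimes t})=0$. A derived $A_\infty$-multiplication on a bigraded operad $\mathcal{O}$ is given by elements $m_{ij}\in\mathcal{O}(j)$ of bidegree $(i,2-i-j)$ satisfying the same relation with $m_{ij}\circ_{r+1}m_{pq}$ in place of $m_{ij}(1^{\otimes r}\otimes m_{pq}\otimes1^{\otimes t})$. Vertical operadic suspension: $\mathfrak{s}\mathcal{O}(n)=\mathcal{O}(n)\otimes\Lambda(n)$, $\Lambda(n)$ generated by $e^n$ in bidegree $(0,n-1)$ with $e^n\circ_ie^m=(-1)^{(n-i)(m-1)}e^{n+m-1}$.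 Explicitly $x\tilde\circ_{r+1}y=(-1)^{(n-1)q+(n-1)(m-1)+r(m-1)}x\circ_{r+1}y$ for $x\in\mathcal{O}(n)$ and $y\in\mathcal{O}(m)$ of vertical degree $q$. $\mathfrak{s}\mathcal{O}$ also denotes the bigraded module $\prod_n\mathfrak{s}\mathcal{O}(n)$, with its natural bidegree ($x\in\mathcal{O}(n)$ of bidegree $(k,d-k)$ has natural bidegree $(k,d+n-k-1)$). Thus $m_{il}$ has natural bidegree $(i,1-i)$. Braces on $\mathfrak{s}\mathcal{O}$: $b_0(x)=x$, $b_n(x;x_1,\dots,x_n)=\sum\tilde\gamma(x;1,\dots,1,x_1,1,\dots,1,x_n,1,\dots,1)$ over all order-preserving insertions, $\tilde\gamma$ being the composition of $\mathfrak{s}\mathcal{O}$. Write $\overline{B}_n$ for the braces on $\mathfrak{s}\mathrm{End}_{S\mathfrak{s}\mathcal{O}}$. For $F:B^{\otimes n}\to B$ let $\overline\sigma(F)=S\circ F\circ(S^{\otimes n})^{-1}$; this gives an operad isomorphism $\overline\sigma:\mathrm{End}_B\cong\mathfrak{s}\mathrm{End}_{SB}$. Structure on $S\mathfrak{s}\mathcal{O}$: for $y,y_1,\dots,y_j\in\mathfrak{s}\mathcal{O}$ of natural bidegrees $(k,d-k)$ and $(k_v,d_v-k_v)$, $M_{i1}(Sy)=\sum_l\big(Sb_1(m_{il};y)-(-1)^{ik+(1-i)(d-k)}Sb_1(y;m_{il})\big)$ and $M_{ij}(Sy_1,\dots,Sy_j)=(-1)^{\sum_{v=1}^j(j-v)(d_v-k_v)}\sum_lSb_j(m_{il};y_1,\dots,y_j)$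 for $j\ge2$. Structure on $S\mathfrak{s}\mathrm{End}_{S\mathfrak{s}\mathcal{O}}$: with $M_{i\bullet}=\sum_jM_{ij}\in\mathfrak{s}\mathrm{End}_{S\mathfrak{s}\mathcal{O}}$, set $\overline{M}'_{i1}(f)=\overline{B}_1(M_{i\bullet};f)-(-1)^{ip+(1-i)q}\overline{B}_1(f;M_{i\bullet})$ for $f$ of natural bidegree $(p,q)$, $\overline{M}'_{ij}(f_1,\dots,f_j)=\overline{B}_j(M_{i\bullet};f_1,\dots,f_j)$ for $j>1$, and $\overline{M}_{ij}=\overline\sigma(\overline{M}'_{ij})$. The map $\Phi':\mathfrak{s}\mathcal{O}\to\mathrm{End}_{\mathfrak{s}\mathcal{O}}=\prod_n\mathrm{End}_{\mathfrak{s}\mathcal{O}}(n)$ has arity $n$ component $x\mapsto b_n(x;-)$, and $\Phi=S\circ\overline\sigma\circ\Phi'\circ S^{-1}$. *)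

(* Defs.v *)
From HB Require Import structures.
From mathcomp Require Import all_boot all_order all_algebra.
From mathcomp Require Import boolp.

Set Implicit Arguments.
Unset Strict Implicit.
Unset Printing Implicit Defensive.

Import GRing.Theory.
Local Open Scope ring_scope.

(* (horizontal, vertical) *)
Definition bidegree : zmodType := (int * int)%type.

Definition bideg (a b : int) : bidegree := (a, b).

Definition pairing (x y : bidegree) : int := x.1 * y.1 + x.2 * y.2.

Definition sgn (R : comPzRingType) (z : int) : R := (-1) ^+ `|z|%N.
Arguments sgn {R} z.

Section DProd.
Variables (R : comPzRingType) (I : Type) (F : I -> lmodType R).

Definition dprod := forall i, F i.

HB.instance Definition _ := gen_eqMixin dprod.
HB.instance Definition _ := gen_choiceMixin dprod.

Definition dprod_zero : dprod := fun=> 0.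
Definition dprod_opp (f : dprod) : dprod := fun i => - f i.
Definition dprod_add (f g : dprod) : dprod := fun i => f i + g i.
Definition dprod_scale (a : R) (f : dprod) : dprod := fun i => a *: f i.

Fact dprod_addA : associative dprod_add.
Proof. by move=> f g h; apply: functional_extensionality_dep => i; exact: addrA. Qed.
Fact dprod_addC : commutative dprod_add.
Proof. by move=> f g; apply: functional_extensionality_dep => i; exact: addrC. Qed.
Fact dprod_add0 : left_id dprod_zero dprod_add.
Proof. by move=> f; apply: functional_extensionality_dep => i; exact: add0r. Qed.
Fact dprod_addN : left_inverse dprod_zero dprod_opp dprod_add.
Proof. by move=> f; apply: functional_extensionality_dep => i; exact: addNr. Qed.

HB.instance Definition _ :=
  GRing.isZmodule.Build dprod dprod_addA dprod_addC dprod_add0 dprod_addN.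

Fact dprod_scaleA a b f : dprod_scale a (dprod_scale b f) = dprod_scale (a * b) f.
Proof. by apply: functional_extensionality_dep => i; exact: scalerA. Qed.
Fact dprod_scale1 : left_id 1 dprod_scale.
Proof. by move=> f; apply: functional_extensionality_dep => i; exact: scale1r. Qed.
Fact dprod_scaleDr : right_distributive dprod_scale +%R.
Proof. by move=> a f g; apply: functional_extensionality_dep => i; exact: scalerDr. Qed.
Fact dprod_scaleDl f : {morph dprod_scale^~ f : a b / a + b}.
Proof. by move=> a b; apply: functional_extensionality_dep => i; exact: scalerDl. Qed.

HB.instance Definition _ := GRing.Zmodule_isLmodule.Build R dprod
  dprod_scaleA dprod_scale1 dprod_scaleDr dprod_scaleDl.

End DProd.

Section Homogeneous.
Variables (R : comPzRingType) (I : eqType) (F : I -> lmodType R).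

(* A homogeneous element: an index (its degree) with an element of that       *)
(* component.                                                                 *)
Definition helt := {i : I & F i}.

Definition hel i (x : F i) : helt := Tagged (fun j => F j) x.

(* The component of index i of a homogeneous element, seen in the product of  *)
(* all the F j: x itself if x has index i (up to transport along a proof of   *)
(* tag x = i), and 0 otherwise.                                               *)
Definition component (i : I) (x : helt) : F i :=
  match tag x =P i with
  | ReflectT e => eq_rect (tag x) (fun j => F j) (tagged x) i e
  | ReflectF _ => 0
  end.

Lemma component_id i (x : F i) : component i (hel x) = x.
Proof.
rewrite /component; case: eqP => //= e.
by rewrite (eq_irrelevance e (erefl i)).
Qed.

Lemma component_neq i (x : helt) : tag x != i -> component i x = 0.
Proof. by rewrite /component; case: eqP. Qed.

Lemma component_lin i j (a : R) (x y : F j) :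
  component i (hel (a *: x + y))
  = a *: component i (hel x) + component i (hel y).
Proof.
have [e|ne] := eqVneq j i; first by case: i / e; rewrite !component_id.
by rewrite !component_neq // scaler0 addr0.
Qed.

End Homogeneous.

Notation bigraded R := (bidegree -> lmodType R).

(* S A; the identity (SA)_d = A_(d - (0,1)) is the inverse of S.              *)
Definition shift (R : comPzRingType) (A : bigraded R) : bigraded R :=
  fun d => A (d - bideg 0 1).

Definition unshift (R : comPzRingType) (A : bigraded R)
  (x : helt (shift A)) : helt A := hel (tagged x : A (tag x - bideg 0 1)).

Definition total_degree (R : comPzRingType) (A : bigraded R)
  (xs : seq (helt A)) : bidegree := \sum_(x <- xs) tag x.

Section MultilinearMaps.
Variables (R : comPzRingType) (A : bigraded R) (n : nat) (p : bidegree).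

(* An R-linear map of bidegree p from the n-th tensor power of A to A, given  *)
(* as a multilinear map on homogeneous elements. The value on x_1, ..., x_n   *)
(* is recorded by all its components; only the one of degree p + sum_v |x_v|  *)
(* may be nonzero. Lists of length other than n carry no information.         *)
Record mmap := MMap {
  mval :> seq (helt A) -> forall e : bidegree, A e;
  mval_supp : forall xs e,
    ~~ ((size xs == n) && (e == p + total_degree xs)) -> mval xs e = 0;
  mval_lin : forall s t d (a : R) (x y : A d) e,
    mval (s ++ hel (a *: x + y) :: t) e
    = a *: mval (s ++ hel x :: t) e + mval (s ++ hel y :: t) e }.

Lemma mmapP (f g : mmap) : (forall xs e, f xs e = g xs e) -> f = g.
Proof.
case: f g => [f fs fl] [g gs gl] /= fg.
have {}fg : f = g.
  apply: functional_extensionality_dep => xs.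
  by apply: functional_extensionality_dep => e; exact: fg.
by case: g / fg gs gl => gs gl; congr MMap; exact: Prop_irrelevance.
Qed.

HB.instance Definition _ := gen_eqMixin mmap.
HB.instance Definition _ := gen_choiceMixin mmap.

Definition mmap_zero : mmap.
Proof.
exists (fun _ _ => 0) => //.
by move=> *; rewrite scaler0 addr0.
Defined.

Definition mmap_opp (f : mmap) : mmap.
Proof.
exists (fun xs e => - f xs e) => [xs e /mval_supp->|s t d a x y e].
  exact: oppr0.
by rewrite mval_lin opprD scalerN.
Defined.

Definition mmap_add (f g : mmap) : mmap.
Proof.
exists (fun xs e => f xs e + g xs e) => [xs e E|s t d a x y e].
  by rewrite !mval_supp // addr0.
by rewrite !mval_lin scalerDr addrACA.
Defined.

Definition mmap_scale (b : R) (f : mmap) : mmap.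
Proof.
exists (fun xs e => b *: f xs e) => [xs e /mval_supp->|s t d a x y e].
  exact: scaler0.
by rewrite mval_lin scalerDr !scalerA mulrC.
Defined.

Fact mmap_addA : associative mmap_add.
Proof. by move=> *; apply: mmapP => *; exact: addrA. Qed.
Fact mmap_addC : commutative mmap_add.
Proof. by move=> *; apply: mmapP => *; exact: addrC. Qed.
Fact mmap_add0 : left_id mmap_zero mmap_add.
Proof. by move=> *; apply: mmapP => *; exact: add0r. Qed.
Fact mmap_addN : left_inverse mmap_zero mmap_opp mmap_add.
Proof. by move=> *; apply: mmapP => *; exact: addNr. Qed.

HB.instance Definition _ :=
  GRing.isZmodule.Build mmap mmap_addA mmap_addC mmap_add0 mmap_addN.

Fact mmap_scaleA a b f : mmap_scale a (mmap_scale b f) = mmap_scale (a * b) f.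
Proof. by apply: mmapP => *; exact: scalerA. Qed.
Fact mmap_scale1 : left_id 1 mmap_scale.
Proof. by move=> *; apply: mmapP => *; exact: scale1r. Qed.
Fact mmap_scaleDr : right_distributive mmap_scale +%R.
Proof. by move=> *; apply: mmapP => *; exact: scalerDr. Qed.
Fact mmap_scaleDl f : {morph mmap_scale^~ f : a b / a + b}.
Proof. by move=> *; apply: mmapP => *; exact: scalerDl. Qed.

HB.instance Definition _ := GRing.Zmodule_isLmodule.Build R mmap
  mmap_scaleA mmap_scale1 mmap_scaleDr mmap_scaleDl.

End MultilinearMaps.

(* op_comp r x y is the partial composition of x and y at the (r+1)-st input  *)
(* of x; it is only meaningful for r < n and is never used for other r.         *)
Record operad_data (R : comPzRingType) := OperadData {
  op_mod :> nat -> bigraded R;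
  op_one : op_mod 1 0;
  op_comp : forall n m d e (r : nat),
    op_mod n d -> op_mod m e -> op_mod (n + m).-1 (d + e);
  op_comp_linl : forall n m d e r (a : R) (x x' : op_mod n d) (y : op_mod m e),
    op_comp r (a *: x + x') y = a *: op_comp r x y + op_comp r x' y;
  op_comp_linr : forall n m d e r (a : R) (x : op_mod n d) (y y' : op_mod m e),
    op_comp r x (a *: y + y') = a *: op_comp r x y + op_comp r x y' }.

Section OperadElements.
Variables (R : comPzRingType) (P : operad_data R).

Definition op_fam (k : nat * bidegree) : lmodType R := P k.1 k.2.

Definition oelt := helt op_fam.

Definition oel n d (x : P n d) : oelt := @hel R _ op_fam (n, d) x.

Definition arity (x : oelt) : nat := (tag x).1.
Definition degree (x : oelt) : bidegree := (tag x).2.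

Definition ocomponent n d (x : oelt) : P n d := component (n, d) x.

Definition oone : oelt := oel (op_one P).

Definition oscale (a : R) (x : oelt) : oelt := @hel R _ op_fam (tag x) (a *: tagged x).

Definition ocomp (r : nat) (x y : oelt) : oelt :=
  @oel (arity x + arity y).-1 (degree x + degree y)
    (op_comp r (tagged x : P (arity x) (degree x)) (tagged y : P (arity y) (degree y))).

(* Non-symmetric operads, with the Koszul sign rule.                          *)
Record operad_laws : Prop := OperadLaws {
  comp1o : forall x : oelt, ocomp 0 oone x = x;
  compo1 : forall (x : oelt) r, (r < arity x)%N -> ocomp r x oone = x;
  comp_seq : forall (x y z : oelt) r k, (r < arity x)%N -> (k < arity y)%N ->
    ocomp (r + k)%N (ocomp r x y) z = ocomp r x (ocomp k y z);
  comp_par : forall (x y z : oelt) r k, (r < k)%N -> (k < arity x)%N ->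
    ocomp (k + arity y).-1 (ocomp r x y) z
    = oscale (sgn (pairing (degree y) (degree z))) (ocomp r (ocomp k x z) y) }.

(* Composes ys.[0], ys.[1], ... into the consecutive inputs of x, the first   *)
(* one at input pos + 1. For pos = 0 and arity x = size ys this is the full   *)
(* operadic composition gamma(x; ys); as for maps composed with tensor        *)
(* products, composing from left to right creates no sign.                    *)
Fixpoint gamma_from (pos : nat) (x : oelt) (ys : seq oelt) : oelt :=
  if ys is y :: ys' then gamma_from (pos + arity y)%N (ocomp pos x y) ys' else x.

Definition gamma (x : oelt) (ys : seq oelt) : oelt := gamma_from 0 x ys.

(* All lists of length N obtained from ys by inserting copies of the unit.    *)
Fixpoint insertions (N : nat) (ys : seq oelt) : seq (seq oelt) :=
  match N, ys with
  | 0, [::] => [:: [::]]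
  | 0, _ :: _ => [::]
  | N'.+1, [::] => [seq oone :: l | l <- insertions N' [::]]
  | N'.+1, y :: ys' =>
      [seq oone :: l | l <- insertions N' ys] ++ [seq y :: l | l <- insertions N' ys']
  end.

(* The component in P T e of b_n(x; y_1, ..., y_n), n = size ys.              *)
Definition obrace (x : oelt) (ys : seq oelt) (T : nat) (e : bidegree) : P T e :=
  \sum_(l <- insertions (arity x) ys) ocomponent T e (gamma x l).

(* The bigraded module prod_n P(n).                                           *)
Definition total : bigraded R := fun d => dprod (fun n => P n d).

(* All the ways of choosing a component of arity at most T in each of the ys. *)
Fixpoint choices (T : nat) (ys : seq (helt total)) : seq (seq oelt) :=
  if ys is y :: ys' then
    [seq oel (tagged y a) :: l | a <- iota 0 T.+1, l <- choices T ys']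
  else [:: [::]].

(* The component of degree e of b_n(x; y_1, ..., y_n), for elements of        *)
(* prod_n P(n). In arity T only the components of x of arity at most T + n    *)
(* and those of the y_v of arity at most T contribute.                        *)
Definition brace (x : helt total) (ys : seq (helt total)) (e : bidegree) : total e :=
  if ys is [::] then component e x else fun T =>
    \sum_(N < (T + size ys).+1) \sum_(l <- choices T ys)
      obrace (oel (tagged x N)) l T e.

End OperadElements.

Arguments brace : simpl never.

Record operad (R : comPzRingType) := Operad {
  operad_op :> operad_data R;
  operadP : operad_laws operad_op }.

Section BraceLinearity.
Variables (R : comPzRingType) (P : operad_data R).

Definition omultilinear (V : lmodType R) (F : seq (oelt P) -> V) := forall s t n d (a : R) (x y : P n d),
  F (s ++ oel (a *: x + y) :: t) = a *: F (s ++ oel x :: t) + F (s ++ oel y :: t).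

Lemma gamma_from_linl pos n d (a : R) (x y : P n d) l T e :
  ocomponent T e (gamma_from pos (oel (a *: x + y)) l)
  = a *: ocomponent T e (gamma_from pos (oel x) l)
    + ocomponent T e (gamma_from pos (oel y) l).
Proof.
elim: l pos n d x y => [|w l IH] pos n d x y; first exact: (@component_lin _ _ (@op_fam R P) (T, e) (n, d)).
by rewrite /= /ocomp /= op_comp_linl IH.
Qed.

Lemma gamma_from_linr pos (x : oelt P) T e :
  omultilinear (fun l => ocomponent T e (gamma_from pos x l)).
Proof.
move=> s; elim: s pos x => [|w s IH] pos x t n d a y z /=; last exact: IH.
by rewrite /ocomp /= op_comp_linr gamma_from_linl.
Qed.

Lemma insertions_lin (V : lmodType R) (F : seq (oelt P) -> V) N :
  omultilinear F -> omultilinear (fun ys => \sum_(l <- insertions N ys) F l).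
Proof.
elim: N F => [|N IH] F linF s t n d a x y.
  by case: s => [|w s] /=; rewrite !big_nil scaler0 addr0.
have linC w : omultilinear (fun l => F (w :: l)).
  by move=> s' t' *; exact: (linF (w :: s')).
case: s => [|w s] /=; rewrite !big_cat !big_map /=.
  rewrite (IH _ (linC _) [::]) scalerDr addrACA; congr (_ + _).
  rewrite scaler_sumr -big_split /=; apply: eq_bigr => l _.
  exact: (linF [::]).
by rewrite (IH _ (linC _) (w :: s)) (IH _ (linC _) s) scalerDr addrACA.
Qed.

Lemma obrace_linl n d (a : R) (x y : P n d) l T e :
  obrace (oel (a *: x + y)) l T e = a *: obrace (oel x) l T e + obrace (oel y) l T e.
Proof.
rewrite /obrace scaler_sumr -big_split /=; apply: eq_bigr => l' _.
exact: gamma_from_linl.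
Qed.

Lemma obrace_linr (x : oelt P) T e : omultilinear (fun l => obrace x l T e).
Proof. by apply: insertions_lin; exact: gamma_from_linr. Qed.

Lemma big_choices_cons (V : lmodType R) (F : seq (oelt P) -> V) T y ys :
  \sum_(l <- choices T (y :: ys)) F l
  = \sum_(c <- iota 0 T.+1) \sum_(l <- choices T ys) F (oel (tagged y c) :: l).
Proof. by rewrite -[choices T _]/(allpairs_dep _ _ _) big_allpairs_dep. Qed.

Lemma choices_lin (V : lmodType R) (F : seq (oelt P) -> V) T s t d (a : R)
    (x y : total P d) : omultilinear F ->
  \sum_(l <- choices T (s ++ hel (a *: x + y) :: t)) F l
  = a *: (\sum_(l <- choices T (s ++ hel x :: t)) F l)
    + \sum_(l <- choices T (s ++ hel y :: t)) F l.
Proof.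
elim: s F => [|w s IH] F linF.
  rewrite !cat0s !big_choices_cons scaler_sumr -big_split; apply: eq_bigr => c _.
  rewrite scaler_sumr -big_split; apply: eq_bigr => l _.
  exact: (linF [::]).
rewrite !cat_cons !big_choices_cons scaler_sumr -big_split.
apply: eq_bigr => c _; apply: (IH (fun l => F (_ :: l))).
by move=> s' t' *; exact: (linF (_ :: s')).
Qed.

Lemma brace_linr (x : helt (total P)) s t d (a : R) (y z : total P d) e :
  brace x (s ++ hel (a *: y + z) :: t) e
  = a *: brace x (s ++ hel y :: t) e + brace x (s ++ hel z :: t) e.
Proof.
have braceE u : brace x (s ++ u :: t) e =
    (fun T => \sum_(N < (T + (size s + size t).+1).+1) \sum_(l <- choices T (s ++ u :: t))
      obrace (oel (tagged x N)) l T e) :> total P e.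
  by rewrite -addnS -[(size t).+1]/(size (u :: t)) -size_cat; case: s.
rewrite !braceE; apply: functional_extensionality_dep => T.
rewrite [RHS]/GRing.add /= /dprod_add /GRing.scale /= /dprod_scale.
rewrite scaler_sumr -big_split /=; apply: eq_bigr => N _.
by apply: choices_lin; exact: obrace_linr.
Qed.

Lemma brace_linl d (a : R) (x y : total P d) ys e :
  brace (hel (a *: x + y)) ys e = a *: brace (hel x) ys e + brace (hel y) ys e.
Proof.
case: ys => [|w ys]; first exact: component_lin.
apply: functional_extensionality_dep => T.
rewrite [RHS]/GRing.add /= /dprod_add /GRing.scale /= /dprod_scale.
rewrite scaler_sumr -big_split /=; apply: eq_bigr => N _.
rewrite scaler_sumr -big_split /=; apply: eq_bigr => l _.
exact: obrace_linl.
Qed.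

Lemma degree_gamma_from pos (x : oelt P) l :
  degree (gamma_from pos x l) = degree x + \sum_(y <- l) degree y.
Proof.
elim: l pos x => [|y l IH] pos x /=; first by rewrite big_nil addr0.
by rewrite IH big_cons addrA.
Qed.

Definition odegree (l : seq (oelt P)) : bidegree := \sum_(y <- l) degree y.

Lemma insertions_supp (V : lmodType R) (F : seq (oelt P) -> V) N ys :
  (forall l, odegree l = odegree ys -> F l = 0) ->
  \sum_(l <- insertions N ys) F l = 0.
Proof.
elim: N F ys => [|N IH] F [|y ys] F0 /=.
- by rewrite big_seq1 F0.
- by rewrite big_nil.
- rewrite big_map; apply: (IH (fun l => F (oone P :: l))) => l El.
  by apply: F0; rewrite /odegree big_cons add0r.
- rewrite big_cat !big_map /=.
  rewrite (IH (fun l => F (oone P :: l))) ?(IH (fun l => F (y :: l))) ?addr0 //.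
    by move=> l El; apply: F0; rewrite /odegree !big_cons; congr (_ + _).
  by move=> l El; apply: F0; rewrite /odegree big_cons add0r.
Qed.

Lemma obrace_supp (x : oelt P) ys T e :
  e != degree x + odegree ys -> obrace x ys T e = 0.
Proof.
move=> ne; apply: insertions_supp => l El.
apply: (@component_neq _ _ (@op_fam R P) (T, e)).
apply: contra ne => /eqP E; apply/eqP.
by rewrite -El -[odegree l]/(\sum_(y <- l) degree y) -(degree_gamma_from 0) /degree E.
Qed.

Lemma choices_supp (V : lmodType R) (F : seq (oelt P) -> V) T ys :
  (forall l, odegree l = total_degree ys -> F l = 0) ->
  \sum_(l <- choices T ys) F l = 0.
Proof.
elim: ys F => [|y ys IH] F F0; first by rewrite big_seq1 F0 // /odegree /total_degree !big_nil.
rewrite big_choices_cons big1 // => c _; apply: (IH (fun l => F (_ :: l))) => l El.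
by apply: F0; rewrite /odegree /total_degree !big_cons; congr (_ + _).
Qed.

Lemma brace_supp (x : helt (total P)) ys e :
  e != tag x + total_degree ys -> brace x ys e = 0.
Proof.
case: ys => [|y ys] ne.
  by apply: component_neq; rewrite eq_sym -[tag x]addr0; move: ne; rewrite /total_degree big_nil.
apply: functional_extensionality_dep => T.
rewrite /brace big1 // => N _; apply: choices_supp => l El.
by apply: obrace_supp; rewrite El.
Qed.

End BraceLinearity.

Section Endomorphisms.
Variables (R : comPzRingType) (A : bigraded R).

Lemma total_degree_cat (s t : seq (helt A)) :
  total_degree (s ++ t) = total_degree s + total_degree t.
Proof. exact: big_cat. Qed.

Lemma total_degree_cons (x : helt A) t : total_degree (x :: t) = tag x + total_degree t.
Proof. exact: big_cons. Qed.

Lemma total_degree_mid (s t : seq (helt A)) d (x y : A d) :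
  total_degree (s ++ hel x :: t) = total_degree (s ++ hel y :: t).
Proof. by rewrite !total_degree_cat !total_degree_cons. Qed.

Lemma mval_lin0 n p (f : mmap A n p) s t d e : f (s ++ hel (0 : A d) :: t) e = 0.
Proof. by have := mval_lin f s t (-1) (0 : A d) 0 e; rewrite addr0 scaler0 scaleN1r addNr. Qed.

Definition mmap_id : mmap A 1 0.
Proof.
exists (fun xs e => if xs is [:: x] then component e x else 0).
  move=> [|x [|y xs]] e //=; rewrite /total_degree big_seq1 add0r eq_sym.
  exact: component_neq.
move=> [|z [|z' s]] [|w t] d a x y e /=; rewrite ?scaler0 ?addr0 //.
exact: component_lin.
Defined.

(* f (1^r (x) g (x) 1^t); moving g past x_1, ..., x_r creates the Koszul sign. *)
Definition mmap_comp_val n m p q (r : nat) (f : mmap A n p) (g : mmap A m q)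
    (xs : seq (helt A)) (e : bidegree) : A e :=
  let ys := take m (drop r xs) in
  sgn (pairing q (total_degree (take r xs))) *:
    f (take r xs ++ hel (g ys (q + total_degree ys)) :: drop (r + m) xs) e.

Lemma mmap_comp_supp n m p q r (f : mmap A n p) (g : mmap A m q) xs e :
  ~~ ((size xs == (n + m).-1) && (e == p + q + total_degree xs)) ->
  mmap_comp_val r f g xs e = 0.
Proof.
rewrite /mmap_comp_val; set ys := take m _ => ne.
have [sz|sz] := eqVneq (size ys) m; last first.
  by rewrite (mval_supp g) ?(negbTE sz) // mval_lin0 scaler0.
rewrite mval_supp ?scaler0 //; apply: contra ne => /andP[/eqP szf /eqP Ee].
have Exs : xs = take r xs ++ ys ++ drop (r + m) xs.
  by rewrite addnC -drop_drop cat_take_drop cat_take_drop.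
apply/andP; split.
  rewrite [in size xs]Exs !size_cat sz -szf size_cat /=.
  by rewrite addnS addSn /= addnCA [(m + _)%N]addnC.
rewrite Ee [in X in _ == X]Exs !total_degree_cat total_degree_cons /=.
by apply/eqP; rewrite -!addrA [q + (total_degree (take r xs) + _)]addrCA.
Qed.

Lemma mmap_comp_lin n m p q r (f : mmap A n p) (g : mmap A m q) s t d (a : R)
    (x y : A d) e :
  mmap_comp_val r f g (s ++ hel (a *: x + y) :: t) e
  = a *: mmap_comp_val r f g (s ++ hel x :: t) e
    + mmap_comp_val r f g (s ++ hel y :: t) e.
Proof.
rewrite /mmap_comp_val.
have [rs|sr] := leqP r (size s); last first.
  have [k ->] : exists k, r = ((size s).+1 + k)%N by exists (r - (size s).+1)%N; rewrite subnKC.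
  have takeE (u : A d) : take ((size s).+1 + k) (s ++ hel u :: t) = s ++ hel u :: take k t.
    by rewrite addSnnS take_cat ltnNge leq_addr /= addKn.
  have dropE l (u : A d) : drop ((size s).+1 + l) (s ++ hel u :: t) = drop l t.
    by rewrite addSnnS drop_cat ltnNge leq_addr /= addKn.
  rewrite -!addnA !takeE !dropE -!catA !cat_cons.
  rewrite !(total_degree_mid _ _ (a *: x + y) y) !(total_degree_mid _ _ x y).
  by rewrite mval_lin scalerDr !scalerA mulrC.
have takeE (u : A d) : take r (s ++ hel u :: t) = take r s by rewrite takel_cat.
have dropE (u : A d) : drop r (s ++ hel u :: t) = drop r s ++ hel u :: t.
  rewrite drop_cat; case: ltngtP rs => // -> _.
  by rewrite subnn drop0 drop_size.
rewrite !takeE addnC -!drop_drop !dropE.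
set s' := drop r s; set b := sgn _.
have [ms|sm] := leqP m (size s').
  have takeE' (u : A d) : take m (s' ++ hel u :: t) = take m s' by rewrite takel_cat.
  have dropE' (u : A d) : drop m (s' ++ hel u :: t) = drop m s' ++ hel u :: t.
    rewrite drop_cat; case: ltngtP ms => // -> _.
    by rewrite subnn drop0 drop_size.
  have catE (w : helt A) u : take r s ++ w :: drop m s' ++ u :: t
      = (take r s ++ w :: drop m s') ++ u :: t by rewrite -catA.
  rewrite !takeE' !dropE' !catE mval_lin scalerDr !scalerA; congr (_ *: _ + _).
  by rewrite mulrC.
have [k Em] : exists k, m = ((size s').+1 + k)%N by exists (m - (size s').+1)%N; rewrite subnKC.
have takeE' (u : A d) : take m (s' ++ hel u :: t) = s' ++ hel u :: take k t.
  by rewrite Em addSnnS take_cat ltnNge leq_addr /= addKn.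
have dropE' (u : A d) : drop m (s' ++ hel u :: t) = drop k t.
  by rewrite Em addSnnS drop_cat ltnNge leq_addr /= addKn.
rewrite !takeE' !dropE'.
rewrite !(total_degree_mid _ _ (a *: x + y) y) !(total_degree_mid _ _ x y).
by rewrite [g _ _]mval_lin mval_lin scalerDr !scalerA mulrC.
Qed.

Definition mmap_comp n m p q (r : nat) (f : mmap A n p) (g : mmap A m q) :
    mmap A (n + m).-1 (p + q) :=
  MMap (@mmap_comp_supp n m p q r f g) (mmap_comp_lin r f g).

Lemma mmap_comp_linl n m p q r (a : R) (f f' : mmap A n p) (g : mmap A m q) :
  mmap_comp r (a *: f + f') g = a *: mmap_comp r f g + mmap_comp r f' g.
Proof.
apply: mmapP => xs e; rewrite /= /mmap_comp_val /= scalerDr !scalerA.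
by congr (_ *: _ + _); exact: mulrC.
Qed.

Lemma mmap_comp_linr n m p q r (a : R) (f : mmap A n p) (g g' : mmap A m q) :
  mmap_comp r f (a *: g + g') = a *: mmap_comp r f g + mmap_comp r f g'.
Proof.
apply: mmapP => xs e; rewrite /= /mmap_comp_val.
set ys := take m _; set c := q + _.
rewrite -[mval (_ + _) ys c]/(a *: g ys c + g' ys c) mval_lin scalerDr !scalerA.
by congr (_ *: _ + _); exact: mulrC.
Qed.

Definition endo : operad_data R :=
  @OperadData R (mmap A) mmap_id mmap_comp mmap_comp_linl mmap_comp_linr.

End Endomorphisms.

Section Suspension.
Variables (R : comPzRingType) (O : operad_data R).

(* The vertical operadic suspension with its natural grading: an element of   *)
(* O n of bidegree c has natural bidegree c + (0, n - 1).                     *)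
Definition susp_mod (n : nat) : bigraded R := fun d => O n (d - bideg 0 (n%:Z - 1)).

Definition susp_one : susp_mod 1 0 := ocomponent 1 _ (oone O).

(* For r < n the element under ocomponent has exactly the announced arity and *)
(* bidegree, so that ocomponent is only a transport.                          *)
Definition susp_comp n m d e (r : nat) (x : susp_mod n d) (y : susp_mod m e) :
    susp_mod (n + m).-1 (d + e) :=
  let q : int := (e - bideg 0 (m%:Z - 1)).2 in
  sgn ((n%:Z - 1) * q + (n%:Z - 1) * (m%:Z - 1) + r%:Z * (m%:Z - 1)) *:
    ocomponent (n + m).-1 _ (oel (op_comp r (x : O n _) (y : O m _))).

Lemma ocomponent_lin T c n d (a : R) (x y : O n d) :
  ocomponent T c (oel (a *: x + y)) = a *: ocomponent T c (oel x) + ocomponent T c (oel y).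
Proof. exact: (@component_lin _ _ (@op_fam R O) (T, c) (n, d)). Qed.

Lemma susp_comp_linl n m d e r (a : R) (x x' : susp_mod n d) (y : susp_mod m e) :
  susp_comp r (a *: x + x') y = a *: susp_comp r x y + susp_comp r x' y.
Proof.
rewrite /susp_comp op_comp_linl ocomponent_lin scalerDr !scalerA.
by congr (_ *: _ + _); exact: mulrC.
Qed.

Lemma susp_comp_linr n m d e r (a : R) (x : susp_mod n d) (y y' : susp_mod m e) :
  susp_comp r x (a *: y + y') = a *: susp_comp r x y + susp_comp r x y'.
Proof.
rewrite /susp_comp op_comp_linr ocomponent_lin scalerDr !scalerA.
by congr (_ *: _ + _); exact: mulrC.
Qed.

Definition susp : operad_data R :=
  @OperadData R susp_mod susp_one susp_comp susp_comp_linl susp_comp_linr.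

End Suspension.

Section SigmaBar.
Variables (R : comPzRingType) (B : bigraded R).

(* The exponent of the Koszul sign of S^{(x) n} on x_1, ..., x_n, that is     *)
(* sum_v (n - v) * (vertical degree of x_v).                                  *)
Fixpoint shift_exponent (xs : seq (helt B)) : int :=
  if xs is x :: xs' then (size xs')%:Z * (tag x).2 + shift_exponent xs' else 0.

Lemma total_degree_unshift (xs : seq (helt (shift B))) :
  total_degree (map (@unshift R B) xs) = total_degree xs - bideg 0 (size xs)%:Z.
Proof.
elim: xs => [|x xs IH]; first by rewrite /total_degree !big_nil subr0.
rewrite map_cons !total_degree_cons IH /= addrACA -opprD; congr (_ + - _).
Qed.

(* S o F o (S^{(x) n})^{-1}, of bidegree d - (0, n - 1) as a map on SB.       *)
Definition sigma_bar_val n d (F : mmap B n d) (xs : seq (helt (shift B)))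
    (e : bidegree) : shift B e :=
  let ys := map (@unshift R B) xs in
  sgn (shift_exponent ys) *: F ys (e - bideg 0 1).

Lemma sigma_bar_supp n d (F : mmap B n d) xs e :
  ~~ ((size xs == n) && (e == d - bideg 0 (n%:Z - 1) + total_degree xs)) ->
  sigma_bar_val F xs e = 0.
Proof.
move=> ne; rewrite /sigma_bar_val mval_supp ?scaler0 //.
apply: contra ne => /andP[]; rewrite size_map => /eqP <- /eqP Ee; rewrite eqxx /=.
rewrite -(subrK (bideg 0 1) e) Ee total_degree_unshift.
rewrite [d - _ + _]addrAC [d + (_ - _)]addrA -!addrA; apply/eqP; congr (_ + (_ + _)).
by congr pair; rewrite //= opprB addrC.
Qed.

Lemma sigma_bar_lin n d (F : mmap B n d) s t c (a : R) (x y : shift B c) e :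
  sigma_bar_val F (s ++ hel (a *: x + y) :: t) e
  = a *: sigma_bar_val F (s ++ hel x :: t) e + sigma_bar_val F (s ++ hel y :: t) e.
Proof.
rewrite /sigma_bar_val !map_cat /=.
have expE (u v : B (c - bideg 0 1)) s' t' :
    shift_exponent (s' ++ hel u :: t') = shift_exponent (s' ++ hel v :: t').
  by elim: s' => //= w s' ->; rewrite !size_cat.
rewrite mval_lin !(expE (a *: x + y) y) !(expE x y) scalerDr !scalerA.
by congr (_ *: _ + _); exact: mulrC.
Qed.

Definition sigma_bar n d (F : endo B n d) : susp (endo (shift B)) n d :=
  MMap (@sigma_bar_supp n d F) (sigma_bar_lin F).

End SigmaBar.

Section BraceStructures.
Variables (R : comPzRingType) (P : operad_data R).

Definition brace_map_val d (x : total P d) (n : nat) (ys : seq (helt (total P)))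
    (e : bidegree) : total P e :=
  if size ys == n then brace (hel x) ys e else 0.

Lemma brace_map_supp d (x : total P d) n ys e :
  ~~ ((size ys == n) && (e == d + total_degree ys)) -> brace_map_val x n ys e = 0.
Proof. by rewrite /brace_map_val; case: eqP => //= _; exact: (@brace_supp _ _ (hel x)). Qed.

Lemma brace_map_lin d (x : total P d) n s t c (a : R) (y z : total P c) e :
  brace_map_val x n (s ++ hel (a *: y + z) :: t) e
  = a *: brace_map_val x n (s ++ hel y :: t) e + brace_map_val x n (s ++ hel z :: t) e.
Proof.
rewrite /brace_map_val !size_cat /=; case: eqP => _; last by rewrite scaler0 addr0.
exact: brace_linr.
Qed.

Definition brace_map d (x : total P d) (n : nat) : endo (total P) n d :=
  MMap (@brace_map_supp d x n) (brace_map_lin x n).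

(* y |-> (-1)^<mu, y> b_1(y; mu); for d = (i, 1 - i) and y of bidegree (p, q) *)
(* the exponent is ip + (1 - i)q.                                             *)
Definition right_brace_map_val d (mu : total P d) (ys : seq (helt (total P)))
    (e : bidegree) : total P e :=
  if ys is [:: y] then sgn (pairing d (tag y)) *: brace y [:: hel mu] e else 0.

Lemma right_brace_map_supp d (mu : total P d) ys e :
  ~~ ((size ys == 1) && (e == d + total_degree ys)) -> right_brace_map_val mu ys e = 0.
Proof.
case: ys => [|y [|y' ys]] //=; rewrite /total_degree big_seq1 => ne.
by rewrite brace_supp ?scaler0 // /total_degree big_seq1 addrC.
Qed.

Lemma right_brace_map_lin d (mu : total P d) s t c (a : R) (y z : total P c) e :
  right_brace_map_val mu (s ++ hel (a *: y + z) :: t) e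
  = a *: right_brace_map_val mu (s ++ hel y :: t) e
    + right_brace_map_val mu (s ++ hel z :: t) e.
Proof.
case: s => [|w [|w' s]]; case: t => [|w'' t]; rewrite /= ?scaler0 ?addr0 //.
rewrite brace_linl scalerDr !scalerA.
by congr (_ *: _ + _); exact: mulrC.
Qed.

Definition right_brace_map d (mu : total P d) : endo (total P) 1 d :=
  MMap (@right_brace_map_supp d mu) (right_brace_map_lin mu).

(* For mu of bidegree (i, 1 - i):                                             *)
(*   M'_1(y) = b_1(mu; y) - (-1)^<mu, y> b_1(y; mu),                          *)
(*   M'_j(y_1, ..., y_j) = b_j(mu; y_1, ..., y_j) for j > 1.                  *)
Definition brace_structure d (mu : total P d) (j : nat) : endo (total P) j d :=
  match j with
  | 0 => 0
  | 1 => brace_map mu 1 - right_brace_map mu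
  | j'.+2 => brace_map mu j'.+2
  end.

(* The structure on S (prod_n P(n)) given by M_ij = sigma_bar(M'_ij):         *)
(*   M_ij(Sy_1, ..., Sy_j)                                                    *)
(*     = (-1)^(sum_v (j - v) (vertical degree of y_v)) S M'_ij(y_1, ..., y_j).*)
(* As a map on S (prod_n P(n)), an element of susp (endo _) j (i, 1 - i) has  *)
(* bidegree (i, 2 - i - j).                                                   *)
Definition shifted_structure d (mu : total P d) (j : nat) :
    susp (endo (shift (total P))) j d :=
  sigma_bar (brace_structure mu j).

(* Phi(Sx) = S sigma_bar(Phi'(x)), with Phi'(x) = sum_n b_n(x; -).            *)
Definition Phi (d : bidegree) (Sx : shift (total P) d) :
    shift (total (susp (endo (shift (total P))))) d :=
  fun n => sigma_bar (brace_map (Sx : total P (d - bideg 0 1)) n).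

End BraceStructures.

Section DerivedMultiplication.
Variables (R : comPzRingType) (O : operad_data R).

(* The elements m i 0 are placeholders and are never used.                    *)
Definition mult_family := forall i j : nat, O j (bideg i%:Z (2 - i%:Z - j%:Z)).

Definition derived_Ainf_multiplication (m : mult_family) : Prop :=
  forall u v : nat, (1 <= v)%N ->
  \sum_(i < u.+1) \sum_(1 <= j < v.+1) \sum_(r < j)
    (let p := (u - i)%N in let q := (v.+1 - j)%N in let t := (j - r.+1)%N in
     sgn (r%:Z * q%:Z + t%:Z + p%:Z * j%:Z) *:
       ocomponent v (bideg u%:Z (3 - u%:Z - v%:Z)) (oel (op_comp r (m i j) (m p q))))
  = 0.

Definition horizontally_bounded_right : Prop :=
  exists N : int, forall n (d : bidegree), (N < d.1)%R -> forall x : O n d, x = 0.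

Variable m : mult_family.

(* sum_l m_il over l >= 1, as an element of the product; ocomponent is only a *)
(* transport from bidegree (i, 2 - i - l) to (i, 1 - i) - (0, l - 1).         *)
Definition mult_sum (i : nat) : total (susp O) (bideg i%:Z (1 - i%:Z)) :=
  fun l => if l is 0 then 0 else ocomponent l _ (oel (m i l)).

Definition M (i j : nat) :
    susp (endo (shift (total (susp O)))) j (bideg i%:Z (1 - i%:Z)) :=
  shifted_structure (mult_sum i) j.

(* sum_j M_ij; there is no term with j = 0, as M i 0 = 0. *)
Definition M_sum (i : nat) :
    total (susp (endo (shift (total (susp O))))) (bideg i%:Z (1 - i%:Z)) :=
  fun j => M i j.

Definition Mbar (i j : nat) :
    susp (endo (shift (total (susp (endo (shift (total (susp O)))))))) j
      (bideg i%:Z (1 - i%:Z)) :=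
  shifted_structure (M_sum i) j.

End DerivedMultiplication.

(* f o MA_ij = MB_ij o f^{(x) j}, for a map f of bidegree (0,0).              *)
Definition derived_Ainf_morphism (R : comPzRingType) (A B : bigraded R)
    (MA : forall i j : nat, susp (endo A) j (bideg i%:Z (1 - i%:Z)))
    (MB : forall i j : nat, susp (endo B) j (bideg i%:Z (1 - i%:Z)))
    (f : forall d, A d -> B d) : Prop :=
  (forall d, linear (f d)) /\
  forall i j : nat, (1 <= j)%N ->
  forall xs : seq (helt A), size xs = j ->
  forall e : bidegree,
    f e ((MA i j : mmap A _ _) xs e)
    = (MB i j : mmap B _ _) [seq hel (f (tag x) (tagged x)) | x <- xs] e.

(* Main.v *)
From HB Require Import structures.
From mathcomp Require Import all_boot all_order all_algebra.
From mathcomp Require Import zify ring.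
From mathcomp Require Import boolp.
Require Import Defs.

Set Implicit Arguments.
Unset Strict Implicit.
Unset Printing Implicit Defensive.

Import GRing.Theory.
Local Open Scope ring_scope.

(** Write P for the suspended operad, A for its total module and Phi' for the
    map sending x to the family of multilinear maps b_n(x; -). Up to shifts,
    Phi is Phi' followed by the suspension isomorphism sigma_bar, so that the
    theorem compares braces of P with braces of the endomorphism operad of A.

    The main point is that Phi' commutes with braces ([brace_Phi']). Evaluated
    at z_1, ..., z_n, the brace B_j(Phi' x; Phi' y_1, ..., Phi' y_j) is the
    signed sum, over all ways to leave some of the z's alone and to feed
    consecutive groups of the others to the y's, of the value of x on the
    resulting list ([endo_braceE]). The brace relation says that
    b_n(b_j(x; y_1, ..., y_j); z_1, ..., z_n) is the same sum, each group being
    fed to its y by a brace ([brace_of_brace]). Both sums are instances of one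
    combinator, [weave], and the brace relation is proved first for single
    operations ([scan_scan]) by reading the inputs of x from left to right:
    the sequential axiom moves a z inside a y, and the parallel axiom moves it
    across the y's to its right, with the Koszul sign. This uses that the
    suspension is an operad ([susp_laws]). Elements of the products are
    reduced to single operations because one component of a brace only depends
    on finitely many components of its arguments.

    Next, sigma_bar is a morphism of operads into the suspension of the shifted
    endomorphism operad ([sigma_bar_comp]), hence commutes with braces
    ([brace_sigma]). It remains to compare the structure defined by
    mu = sum_l m_il with the family Phi' mu. They agree except in arity 0, where
    the structure has no term, and in arity 1, where it has the extra term
    y |-> - (-1)^<mu, y> b_1(y; mu). Their difference, [correction], is
    concentrated in arities at most 1, so that it has no effect on braces with
    at least two entries ([brace_correction_eq0]). For j = 1 it enters both
    halves of the commutator and cancels ([brace_correction_commute]), because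
    the brace relation for b_1(b_n(y; z_1, ..., z_n); mu) lists exactly the ways
    to insert mu between the z's or into one of them. *)

(** * Signs and homogeneous elements *)
Section Signs.
Variable R : comPzRingType.

Lemma sgnD a b : sgn (a + b) = sgn a * sgn b :> R.
Proof.
rewrite /sgn -signr_odd -[in RHS]signr_odd -[in X in _ * X]signr_odd -signr_addb.
by congr (_ ^+ _); lia.
Qed.

Lemma sgn_sqr a : sgn a * sgn a = 1 :> R.
Proof. by rewrite /sgn -expr2 sqrr_sign. Qed.

Lemma eq_sgn a b c : a = b + c + c -> sgn a = sgn b :> R.
Proof. by move->; rewrite !sgnD -mulrA sgn_sqr mulr1. Qed.

End Signs.

Lemma pairingC x y : pairing x y = pairing y x.
Proof. by rewrite /pairing mulrC [x.2 * _]mulrC. Qed.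

Lemma pairingDl x y z : pairing (x + y) z = pairing x z + pairing y z.
Proof. by rewrite /pairing /= !mulrDl addrACA. Qed.

Lemma pairingDr x y z : pairing x (y + z) = pairing x y + pairing x z.
Proof. by rewrite ![pairing x _]pairingC pairingDl. Qed.

Lemma pairing0l x : pairing 0 x = 0.
Proof. by rewrite /pairing /= !mul0r. Qed.

Lemma pairing0r x : pairing x 0 = 0.
Proof. by rewrite pairingC pairing0l. Qed.

Section PointwiseLinear.
Variables (R : comPzRingType) (V W : lmodType R) (f : V -> W).
Hypothesis f_lin : forall a x y, f (a *: x + y) = a *: f x + f y.

Lemma lin_zero : f 0 = 0.
Proof. by have := f_lin (-1) 0 0; rewrite addr0 scaler0 scaleN1r addNr. Qed.

Lemma lin_scale a x : f (a *: x) = a *: f x.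
Proof. by rewrite -[a *: x]addr0 f_lin lin_zero addr0. Qed.

Lemma lin_add x y : f (x + y) = f x + f y.
Proof. by rewrite -[x]scale1r f_lin !scale1r. Qed.

Lemma lin_sum (I : Type) (r : seq I) (F : I -> V) :
  f (\sum_(i <- r) F i) = \sum_(i <- r) f (F i).
Proof. exact: (big_morph f lin_add lin_zero). Qed.

End PointwiseLinear.

Section Oelt.
Variables (R : comPzRingType) (P : operad_data R).

Lemma oel_ocomponent n d (x : oelt P) :
  arity x = n -> degree x = d -> oel (ocomponent n d x) = x.
Proof. by case: x => -[n' d'] x /= <- <-; rewrite /ocomponent component_id. Qed.

Lemma oscaleA a b (x : oelt P) : oscale a (oscale b x) = oscale (a * b) x.
Proof. by rewrite /oscale /= scalerA. Qed.

Lemma oscale1 (x : oelt P) : oscale 1 x = x.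
Proof. by case: x => i x; rewrite /oscale /= scale1r. Qed.

Lemma ocomp_scalel a r (x y : oelt P) : ocomp r (oscale a x) y = oscale a (ocomp r x y).
Proof.
rewrite /ocomp /oscale /oel /=; congr hel.
exact: (lin_scale (fun b u v => op_comp_linl r b u v (tagged y))).
Qed.

Lemma ocomp_scaler a r (x y : oelt P) : ocomp r x (oscale a y) = oscale a (ocomp r x y).
Proof.
rewrite /ocomp /oscale /oel /=; congr hel.
exact: (lin_scale (fun b u v => op_comp_linr r b (tagged x) u v)).
Qed.

Lemma arity_ocomp r (x y : oelt P) : arity (ocomp r x y) = (arity x + arity y).-1.
Proof. by []. Qed.

Lemma degree_ocomp r (x y : oelt P) : degree (ocomp r x y) = degree x + degree y.
Proof. by []. Qed.

Lemma degree_oscale a (x : oelt P) : degree (oscale a x) = degree x.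
Proof. by []. Qed.

End Oelt.

(** * The suspension of an operad is an operad *)
Section SuspensionLaws.
Variables (R : comPzRingType) (O : operad_data R).

(** The same operation with its degree in O. As this is injective, the operad
    laws of the suspension reduce to those of O and a comparison of signs. *)
Definition desusp (x : oelt (susp O)) : oelt O :=
  @oel R O (arity x) (degree x - bideg 0 ((arity x)%:Z - 1)) (tagged x).

(** The component taken here is only a transport along
    (d + c) - c = d. *)
Definition resusp (x : oelt O) : oelt (susp O) :=
  @oel R (susp O) (arity x) (degree x + bideg 0 ((arity x)%:Z - 1))
    (ocomponent (arity x) (degree x + _ - _) x).

Lemma desuspK : cancel desusp resusp.
Proof.
move=> [[n d] x]; rewrite /resusp /desusp /=.
rewrite /arity /degree /=.
move: (d - _ + _) (subrK (bideg 0 (n%:Z - 1)) d) => d' E.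
by subst d'; rewrite /ocomponent component_id.
Qed.

Definition susp_exponent (n m : nat) (q : int) (r : nat) : int :=
  (n%:Z - 1) * q + (n%:Z - 1) * (m%:Z - 1) + r%:Z * (m%:Z - 1).

Lemma degree_desusp x : degree (desusp x) = degree x - bideg 0 ((arity x)%:Z - 1).
Proof. by []. Qed.

Lemma desusp_oscale a x : desusp (oscale a x) = oscale a (desusp x).
Proof. by []. Qed.

Lemma desusp_comp r x y : (r < arity x)%N ->
  desusp (ocomp r x y) = oscale (sgn (susp_exponent (arity x) (arity y) (degree (desusp y)).2 r))
    (ocomp r (desusp x) (desusp y)).
Proof.
case: x y => [[n d] x] [[m e] y]; rewrite /arity /= => rn.
rewrite {1}/desusp /= /susp_comp.
rewrite -[X in oel X]/(_ *: ocomponent _ _ _).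
set w := (ocomp r (desusp _) (desusp _)).
have -> : oel (op_comp r (x : O n _) (y : O m _)) = w by [].
rewrite -[LHS]/(oscale (sgn _) (oel (ocomponent _ _ w))) oel_ocomponent //.
rewrite /w /degree /= /degree /= /arity /=.
rewrite addrACA -opprD; congr (_ - (_, _)) => /=.
rewrite /arity /=; clear -rn; lia.
Qed.

Lemma desusp_one : desusp (oone (susp O)) = oone O.
Proof.
exact: (@oel_ocomponent R O 1 (0 - bideg 0 (1%N%:Z - 1)) (oone O)).
Qed.

(** For sequential composition the two exponents are equal as integers. For
    parallel composition they differ by an even number, once the pairing of
    natural degrees is compared with the pairing of the degrees in O. *)
Lemma susp_laws : operad_laws O -> operad_laws (susp O).
Proof.
move=> laws; have inj := can_inj desuspK; split.
- move=> x; apply: inj; rewrite desusp_comp // desusp_one // comp1o //.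
    by rewrite /susp_exponent -[arity (oone _)]/1%N subrr !mul0r oscale1.
  - move=> x r rx; apply: inj; rewrite desusp_comp // desusp_one // compo1 //.
    by rewrite /susp_exponent -[arity (oone _)]/1%N subrr !mulr0 oscale1.
  - move=> x y z r k rx ky; apply: inj.
    rewrite !desusp_comp // ?arity_ocomp; [|lia..].
    rewrite ocomp_scalel ocomp_scaler !oscaleA comp_seq //; congr oscale.
    rewrite -!sgnD; congr sgn.
    rewrite /susp_exponent degree_oscale degree_ocomp !degree_desusp.
    have -> : (arity x + arity y).-1%:Z = (arity x)%:Z + (arity y)%:Z - 1 by lia.
    have -> : (arity y + arity z).-1%:Z = (arity y)%:Z + (arity z)%:Z - 1 by lia.
    rewrite PoszD /=.
    by ring.
  - move=> x y z r k rk kx; apply: inj; have rx := ltn_trans rk kx.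
    rewrite desusp_oscale !desusp_comp // ?arity_ocomp; [|lia..].
    rewrite !ocomp_scalel !oscaleA
      (comp_par laws (x := desusp x) (desusp y) (desusp z) rk kx) !oscaleA; congr oscale.
    rewrite -!sgnD; rewrite /susp_exponent !degree_desusp /pairing.
    have E w : (arity x + arity w).-1%:Z = (arity x)%:Z + (arity w)%:Z - 1 by lia.
    rewrite !{}E.
    have -> : (k + arity y).-1%:Z = k%:Z + (arity y)%:Z - 1 by lia.
    apply: (@eq_sgn _ _ _ (- (((arity z)%:Z - 1) * ((degree y).2 - ((arity y)%:Z - 1))))).
    by move: (degree y) (degree z) => [y1 y2] [z1 z2] /=; ring.
Qed.

End SuspensionLaws.

(** * Distributing arguments over nested operations *)
Section Weave.
Variables (R : comPzRingType) (V : lmodType R) (Y Z : Type).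
Variables (dY : Y -> bidegree) (dZ : Z -> bidegree).
Variable graft : Y -> seq Z -> (Z -> V) -> V.

Definition degree_sum (T : Type) (d : T -> bidegree) (s : seq T) : bidegree := \sum_(x <- s) d x.

(** The right-hand side of the brace relation: the sum of k over all lists
    obtained from ys, in order, by feeding to each y a block of consecutive
    elements of zs and leaving the other z's around the y's. Reading from left
    to right, a z that is left alone passes all the remaining y's, and a z that
    is fed to y passes those after y, whence the signs. The operation
    graft y t k stands for k applied to y with inputs t; it takes the
    continuation k because the result may be a sum of elements of
    different types. *)
Fixpoint weave (ys : seq Y) (zs : seq Z) (k : seq Z -> V) {struct ys} : V :=
  if ys is y :: ys' then
    (fix skip (zs : seq Z) (k : seq Z -> V) {struct zs} : V :=
       (if zs is z :: zs' then
          sgn (pairing (dY y + degree_sum dY ys') (dZ z)) *: skip zs' (fun l => k (z :: l))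
        else 0)
       + \sum_(a < (size zs).+1)
           sgn (pairing (degree_sum dY ys') (degree_sum dZ (take a zs))) *:
             graft y (take a zs) (fun v => weave ys' (drop a zs) (fun l => k (v :: l))))
    zs k
  else k zs.

(** The terms in which no further z is left alone before y. *)
Definition weave_here (y : Y) ys zs k : V :=
  \sum_(a < (size zs).+1)
    sgn (pairing (degree_sum dY ys) (degree_sum dZ (take a zs))) *:
      graft y (take a zs) (fun v => weave ys (drop a zs) (fun l => k (v :: l))).

Lemma weave_nil zs k : weave [::] zs k = k zs.
Proof. by []. Qed.

Lemma weave_cons_nil y ys k : weave (y :: ys) [::] k = weave_here y ys [::] k.
Proof. by rewrite /= add0r. Qed.

Lemma weave_cons y ys z zs k :
  weave (y :: ys) (z :: zs) k
  = sgn (pairing (dY y + degree_sum dY ys) (dZ z)) *: weave (y :: ys) zs (fun l => k (z :: l))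
    + weave_here y ys (z :: zs) k.
Proof. by []. Qed.

Lemma graft_ext y t k k' : (forall v, k v = k' v) -> graft y t k = graft y t k'.
Proof. by move=> /funext ->. Qed.

Lemma weave_ext ys zs k k' :
  (forall l, (size ys <= size l <= size ys + size zs)%N -> k l = k' l) ->
  weave ys zs k = weave ys zs k'.
Proof.
elim: ys zs k k' => [|y ys IH] zs k k' kk'; first by apply: kk' => /=.
have here zs' j j' :
    (forall l, (size ys < size l <= (size ys + size zs').+1)%N -> j l = j' l) ->
    weave_here y ys zs' j = weave_here y ys zs' j'.
  move=> jj'; apply: eq_bigr => a _; congr (_ *: _).
  apply: graft_ext => v; apply: IH => l; rewrite size_drop => sl.
  by apply: jj' => /=; lia.
elim: zs k k' kk' => [|z zs IHz] k k' kk'; first by rewrite !weave_cons_nil; exact: here.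
rewrite !weave_cons; congr (_ *: _ + _); last by apply: here => l sl; apply: kk'.
by apply: IHz => l /= sl; apply: kk' => /=; lia.
Qed.

Hypothesis graft_lin : forall y t a k k',
  graft y t (fun v => a *: k v + k' v) = a *: graft y t k + graft y t k'.

Lemma weave_lin ys zs a k k' :
  weave ys zs (fun l => a *: k l + k' l) = a *: weave ys zs k + weave ys zs k'.
Proof.
elim: ys zs k k' => [|y ys IH] zs k k' //.
have here zs' j j' : weave_here y ys zs' (fun l => a *: j l + j' l)
    = a *: weave_here y ys zs' j + weave_here y ys zs' j'.
  rewrite /weave_here scaler_sumr -big_split /=; apply: eq_bigr => c _.
  rewrite (@graft_ext _ _ _ (fun v => a *: weave ys (drop c zs') (fun l => j (v :: l))
      + weave ys (drop c zs') (fun l => j' (v :: l)))) => [|v]; last exact: IH.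
  by rewrite graft_lin scalerDr !scalerA mulrC.
elim: zs k k' => [|z zs IHz] k k'; first by rewrite !weave_cons_nil here.
by rewrite !weave_cons IHz here !scalerDr !scalerA mulrC addrACA.
Qed.

Lemma weave_add ys zs k k' :
  weave ys zs (fun l => k l + k' l) = weave ys zs k + weave ys zs k'.
Proof.
rewrite -[weave ys zs k]scale1r -weave_lin; apply: weave_ext => l _.
by rewrite scale1r.
Qed.

Lemma weave0 ys zs : weave ys zs (fun=> 0) = 0.
Proof.
have := weave_add ys zs (fun=> 0) (fun=> 0); under eq_fun do rewrite addr0.
by move/eqP; rewrite addrC -subr_eq subrr => /eqP.
Qed.

Lemma weave_sum (I : Type) (r : seq I) ys zs (k : I -> seq Z -> V) :
  weave ys zs (fun l => \sum_(i <- r) k i l) = \sum_(i <- r) weave ys zs (k i).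
Proof.
elim: r => [|i r IH].
  rewrite big_nil -[RHS](weave0 ys zs); apply: weave_ext => l _.
  by rewrite big_nil.
rewrite big_cons -IH -weave_add; apply: weave_ext => l _.
by rewrite big_cons.
Qed.

End Weave.

(** * Braces of operations, one input at a time *)
Section Scan.
Variables (R : comPzRingType) (P : operad_data R) (V : lmodType R).
Implicit Types (x y z w : oelt P) (F k : oelt P -> V).

Definition arities (l : seq (oelt P)) : nat := (\sum_(y <- l) arity y)%N.

(** The brace b(x; ys), followed by F, computed by reading the inputs of x from
    left to right: each is left empty or receives the next y. Here pos is the
    first input still to be read in the composite x obtained so far, and N the
    number of inputs still to be read. *)
Fixpoint scan (N pos : nat) x (ys : seq (oelt P)) F {struct N} : V :=
  match ys, N with
  | [::], _ => F x
  | _ :: _, 0 => 0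
  | y :: ys', N'.+1 =>
      scan N' pos.+1 x ys F + scan N' (pos + arity y) (ocomp pos x y) ys' F
  end.

Lemma scan_nil N pos x F : scan N pos x [::] F = F x.
Proof. by case: N. Qed.

Lemma scan_cons N pos x y ys F :
  scan N.+1 pos x (y :: ys) F
  = scan N pos.+1 x (y :: ys) F + scan N (pos + arity y) (ocomp pos x y) ys F.
Proof. by []. Qed.

Lemma scan0_cons pos x y ys F : scan 0 pos x (y :: ys) F = 0.
Proof. by []. Qed.

Lemma scanS N pos x ys F :
  scan N.+1 pos x ys F
  = scan N pos.+1 x ys F
    + (if ys is y :: ys' then scan N (pos + arity y) (ocomp pos x y) ys' F else 0).
Proof. by case: ys => [|y ys] //; rewrite !scan_nil addr0. Qed.

Lemma scan_add N pos x ys F G :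
  scan N pos x ys (fun w => F w + G w) = scan N pos x ys F + scan N pos x ys G.
Proof.
elim: N pos x ys => [|N IH] pos x [|y ys] /=; rewrite ?addr0 //.
by rewrite !IH addrACA.
Qed.

Lemma scan_scale N pos x ys F a :
  scan N pos x ys (fun w => a *: F w) = a *: scan N pos x ys F.
Proof.
elim: N pos x ys => [|N IH] pos x [|y ys] /=; rewrite ?scaler0 //.
by rewrite !IH scalerDr.
Qed.

(** The scan only meets operations whose arity and degree are determined by
    those of x and ys. *)
Lemma scan_ext N pos x ys F G : (pos + N <= arity x)%N ->
  (forall w, (size ys <= N)%N -> (arity w + size ys = arity x + arities ys)%N ->
     degree w = degree x + odegree ys -> F w = G w) ->
  scan N pos x ys F = scan N pos x ys G.
Proof.
rewrite /arities /odegree.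
elim: N pos x ys => [|N IH] pos x [|y ys] //= Nx FG.
- by apply: FG; rewrite // big_nil ?addr0.
- by apply: FG; rewrite // big_nil ?addr0.
congr (_ + _); first by apply: IH => [|w sN Ea Ed]; [lia|apply: FG; rewrite // ltnW].
apply: IH => [|w sN Ea Ed]; first by rewrite arity_ocomp; lia.
apply: FG; rewrite ?big_cons; first by lia.
  by move: Ea; rewrite arity_ocomp; lia.
by rewrite Ed addrA.
Qed.

Lemma scan_ext_all N pos x ys F G : (forall w, F w = G w) ->
  scan N pos x ys F = scan N pos x ys G.
Proof. by move=> /funext ->. Qed.

Definition linear_on_oelts F := forall n d a (x y : P n d),
  F (oel (a *: x + y)) = a *: F (oel x) + F (oel y).

Lemma linear_on_oeltsZ F a x : linear_on_oelts F -> F (oscale a x) = a *: F x.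
Proof.
by move=> linF; case: x => -[n d] x; exact: (lin_scale (linF n d)).
Qed.

Lemma scan_linl N pos ys F : linear_on_oelts F ->
  linear_on_oelts (fun x => scan N pos x ys F).
Proof.
move=> linF; elim: N pos ys => [|N IH] pos [|y ys] n d a u v /=; rewrite ?linF //.
  by rewrite scaler0 addr0.
rewrite IH scalerDr addrACA; congr (_ + _).
by rewrite /ocomp /= op_comp_linl IH.
Qed.

Lemma scan_linr N pos x F : linear_on_oelts F ->
  omultilinear (fun ys => scan N pos x ys F).
Proof.
move=> linF; elim: N pos x => [|N IH] pos x s t n d a u v.
  by case: s => [|y s] /=; rewrite scaler0 addr0.
case: s => [|y s] /=.
  rewrite (IH _ _ [::]) scalerDr addrACA; congr (_ + _).
  by rewrite /ocomp /= op_comp_linr (scan_linl _ _ _ linF).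
by rewrite (IH _ _ (y :: s)) (IH _ _ s) scalerDr addrACA.
Qed.

Hypothesis laws : operad_laws P.

Lemma gamma_scanE N pos x ys F : (pos + N <= arity x)%N ->
  \sum_(l <- insertions N ys) F (gamma_from pos x l) = scan N pos x ys F.
Proof.
elim: N pos x ys => [|N IH] pos x [|y ys] //= Nx.
- by rewrite big_seq1.
- by rewrite big_nil.
- rewrite big_map /= (compo1 laws); last lia.
  rewrite -[LHS]/(\sum_(l <- _) F (gamma_from (pos + 1) x l)).
  by rewrite addn1 IH ?scan_nil //; lia.
rewrite big_cat !big_map /= (compo1 laws); last lia.
congr (_ + _).
  rewrite -[LHS]/(\sum_(l <- _) F (gamma_from (pos + 1) x l)) addn1 IH //; lia.
by rewrite IH // arity_ocomp; lia.
Qed.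

(** By the parallel axiom, composing z at an input to the left of those being
    read commutes with reading them, up to the sign of z passing the ys. *)
Lemma scan_ocomp_par p z N pos x ys F : linear_on_oelts F ->
  (p < pos)%N -> (pos + N <= arity x)%N ->
  scan N (pos + arity z).-1 (ocomp p x z) ys F
  = sgn (pairing (odegree ys) (degree z)) *: scan N pos x ys (fun w => F (ocomp p w z)).
Proof.
move=> linF; elim: N pos x ys => [|N IH] pos x [|y ys] pp Nx /=;
  rewrite /odegree ?big_nil ?pairing0l ?scale1r ?scaler0 //.
rewrite scalerDr; congr (_ + _).
  have -> : (pos + arity z).-1.+1 = (pos.+1 + arity z).-1 by lia.
  by apply: IH; lia.
rewrite (comp_par laws) //; last lia.
rewrite (linear_on_oeltsZ _ _ (scan_linl _ _ _ linF)).
have -> : ((pos + arity z).-1 + arity y = (pos + arity y + arity z).-1)%N by lia.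
rewrite IH ?arity_ocomp; [|lia..].
by rewrite scalerA -sgnD big_cons pairingDl pairingC.
Qed.

Lemma scan_ocomp_seq p x N pos y ys F :
  (p < arity x)%N -> (pos + N <= arity y)%N ->
  scan N (p + pos) (ocomp p x y) ys F = scan N pos y ys (fun w => F (ocomp p x w)).
Proof.
move=> px; elim: N pos y ys => [|N IH] pos y [|z ys] Ny //=.
rewrite -addnS IH ?(comp_seq laws) //; [|lia..].
by rewrite -addnA IH // arity_ocomp; lia.
Qed.

End Scan.

Section OeltBraceRelation.
Variables (R : comPzRingType) (P : operad_data R) (V : lmodType R).
Hypothesis laws : operad_laws P.
Implicit Types (x y z w : oelt P) (F k : oelt P -> V).

(** The brace of w with zs restricted to the inputs of w from pos on. *)
Definition scan_after pos w zs F : V := scan (arity w - pos) pos w zs F.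

Lemma scan_after_lin pos zs F : linear_on_oelts F ->
  linear_on_oelts (fun w => scan_after pos w zs F).
Proof. by move=> linF n d a x y; exact: (scan_linl _ _ _ linF). Qed.

(** In [scan_scan], the M inputs of x from pos on are those of a y that has just
    been inserted: they receive an initial segment of zs and none of the ys. *)
Lemma scan_block M N pos x ys zs F : linear_on_oelts F -> (pos + M + N = arity x)%N ->
  scan N (pos + M) x ys (fun w => scan_after pos w zs F)
  = \sum_(a < (size zs).+1) sgn (pairing (odegree ys) (odegree (take a zs))) *:
      scan M pos x (take a zs) (fun w =>
        scan N (arity w - N) w ys (fun v => scan_after (arity w - N) v (drop a zs) F)).
Proof.
move=> linF; elim: M pos x zs => [|M IH] pos x zs Ex.
  rewrite big_ord_recl big1 => [|a _]; last first.
    by case: zs a => [[]|z zs a] //=; rewrite scaler0.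
  rewrite addr0 take0 drop0 /odegree big_nil pairing0r scale1r scan_nil -Ex.
  by rewrite !addn0 addnK.
case: zs => [|z zs].
  rewrite big_ord_recl big_ord0 addr0 /= /odegree big_nil pairing0r scale1r -Ex.
  by rewrite addnK; apply: scan_ext_all => w; rewrite /scan_after !scan_nil.
rewrite (@scan_ext _ _ _ _ _ _ _ _ (fun w => scan_after pos.+1 w (z :: zs) F
    + scan_after (pos + arity z) (ocomp pos w z) zs F)); first last.
- move=> w Ny Ew _; rewrite /scan_after arity_ocomp.
  have -> : (arity w - pos = (arity w - pos.+1).+1)%N by lia.
  by rewrite scan_cons; congr (_ + scan _ _ _ _ _); lia.
- by rewrite Ex.
rewrite scan_add addnS -addSn IH; last by lia.
have -> : scan N (pos.+1 + M) x ys (fun w => scan_after (pos + arity z) (ocomp pos w z) zs F)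
  = sgn (pairing (odegree ys) (degree z)) *:
      scan N (pos + arity z + M) (ocomp pos x z) ys (fun w => scan_after (pos + arity z) w zs F).
  have -> : (pos + arity z + M = (pos.+1 + M + arity z).-1)%N by lia.
  rewrite (scan_ocomp_par laws z ys (scan_after_lin (pos + arity z) zs linF)); [|lia..].
  by rewrite scalerA sgn_sqr scale1r.
rewrite IH; last by rewrite arity_ocomp; lia.
under [RHS]eq_bigr do rewrite scanS scalerDr.
rewrite [RHS]big_split /=; congr (_ + _).
rewrite [RHS]big_ord_recl /= scaler0 add0r scaler_sumr; apply: eq_bigr => a _ /=.
rewrite scalerA -sgnD /odegree big_cons pairingDr; congr (_ *: _).
Qed.

Definition oelt_graft y t k : V := scan (arity y) 0 y t k.

Lemma oelt_graft_lin y t a k k' :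
  oelt_graft y t (fun v => a *: k v + k' v) = a *: oelt_graft y t k + oelt_graft y t k'.
Proof. by rewrite /oelt_graft scan_add scan_scale. Qed.

Notation oweave := (weave (@degree R P) (@degree R P) oelt_graft).

(** The brace relation for single operations. Reading the first input of x,
    either it is left empty by the ys, and then left empty by the zs or filled
    with the next z, or it receives y, whose own inputs take an initial segment
    of zs ([scan_block]); these are the three kinds of terms of [weave]. *)
Lemma scan_scan N pos x ys zs F : linear_on_oelts F -> (pos + N = arity x)%N ->
  scan N pos x ys (fun w => scan_after pos w zs F)
  = oweave ys zs (fun l => scan N pos x l F).
Proof.
move=> linF; elim: N pos x ys zs => [|N IH] pos x [|y ys] zs Ex.
- by rewrite scan_nil weave_nil /scan_after -Ex addKn.
- rewrite scan0_cons -[LHS](weave0 (@degree R P) (@degree R P) oelt_graft_lin (y :: ys) zs).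
  by apply: weave_ext => -[].
- by rewrite scan_nil weave_nil /scan_after -Ex addKn.
have Ey : arity (ocomp pos x y) = (pos + arity y + N)%N by rewrite arity_ocomp; lia.
rewrite scan_cons (@scan_block (arity y) N pos _ ys) //.
under [in RHS]eq_fun do rewrite scanS.
rewrite (weave_add _ _ oelt_graft_lin) -IH; last by lia.
have here_eq zs' : weave_here (@degree R P) (@degree R P) oelt_graft y ys zs' (fun l =>
     if l is h :: l' then scan N (pos + arity h) (ocomp pos x h) l' F else 0)
  = \sum_(a < (size zs').+1) sgn (pairing (odegree ys) (odegree (take a zs'))) *:
      scan (arity y) pos (ocomp pos x y) (take a zs') (fun w =>
        scan N (arity w - N) w ys (fun v => scan_after (arity w - N) v (drop a zs') F)).
  apply: eq_bigr => a _; congr (_ *: _).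
  rewrite -[X in _ = scan _ X _ _ _]addn0 (scan_ocomp_seq laws); [|lia..].
  apply: scan_ext => [//|v _ _ _].
  have Ev : arity (ocomp pos x v) = (pos + arity v + N)%N by rewrite arity_ocomp; lia.
  by rewrite Ev addnK IH.
case: zs => [|z zs].
  by rewrite weave_cons_nil here_eq; congr (_ + _); apply: scan_ext_all => w;
    rewrite /scan_after !scan_nil.
rewrite weave_cons here_eq addrA; congr (_ + _).
rewrite (@scan_ext _ _ _ _ _ _ _ _ (fun w => scan_after pos.+1 w (z :: zs) F
    + scan_after (pos + arity z) (ocomp pos w z) zs F)); first last.
- move=> w Ny Ew _; rewrite /scan_after arity_ocomp.
  have -> : (arity w - pos = (arity w - pos.+1).+1)%N by move: Ny Ew => /=; lia.
  by rewrite scan_cons; congr (_ + scan _ _ _ _ _); lia.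
- by lia.
rewrite scan_add; congr (_ + _).
rewrite -IH; last by rewrite arity_ocomp; lia.
have -> : (pos + arity z = (pos.+1 + arity z).-1)%N by lia.
rewrite (scan_ocomp_par laws z (y :: ys) (scan_after_lin _ zs linF)); [|lia..].
by rewrite /odegree big_cons scalerA sgn_sqr scale1r.
Qed.

End OeltBraceRelation.

(** * Braces in the product of all arities *)
Section Sums.
Variables (V : zmodType).

Lemma sum_ord_tail (m n : nat) (f : nat -> V) : (m <= n)%N ->
  (forall i, (m <= i)%N -> f i = 0) -> \sum_(i < n) f i = \sum_(i < m) f i.
Proof.
move=> mn f0; rewrite -(subnKC mn) big_split_ord /= [X in _ + X]big1 ?addr0 // => i _.
by rewrite f0 ?leq_addr.
Qed.

End Sums.

Section Choices.
Variables (R : comPzRingType) (P : operad_data R) (V : zmodType).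
Implicit Types (F : seq (oelt P) -> V).

Lemma choices_nil T F : \sum_(l <- choices (P := P) T [::]) F l = F [::].
Proof. by rewrite big_seq1. Qed.

Lemma choices_cons T y ys F :
  \sum_(l <- choices T (y :: ys)) F l
  = \sum_(c < T.+1) \sum_(l <- choices T ys) F (@oel R P c (tag y) (tagged y c) :: l).
Proof.
rewrite -[choices T (y :: ys)]/(allpairs_dep _ _ _) big_allpairs_dep.
by rewrite -[iota 0 T.+1]/(index_iota 0 T.+1) big_mkord.
Qed.

Lemma choices_cat T ys zs F :
  \sum_(l <- choices T (ys ++ zs)) F l
  = \sum_(s <- choices (P := P) T ys) \sum_(t <- choices T zs) F (s ++ t).
Proof.
elim: ys F => [|y ys IH] F; first by rewrite choices_nil.
by rewrite cat_cons !choices_cons; apply: eq_bigr => c _; rewrite IH.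
Qed.

Lemma eq_choices T ys F G :
  (forall l, odegree l = total_degree ys -> size l = size ys -> F l = G l) ->
  \sum_(l <- choices (P := P) T ys) F l = \sum_(l <- choices T ys) G l.
Proof.
elim: ys F G => [|y ys IH] F G FG.
  by rewrite !choices_nil FG // /odegree /total_degree !big_nil.
rewrite !choices_cons; apply: eq_bigr => c _; apply: IH => l Ed Es.
by apply: FG; rewrite /= ?Es // total_degree_cons -Ed /odegree big_cons.
Qed.

Lemma choices_take_drop T a ys (F : seq (oelt P) -> seq (oelt P) -> V) :
  (a <= size ys)%N ->
  \sum_(l <- choices T ys) F (take a l) (drop a l)
  = \sum_(s <- choices T (take a ys)) \sum_(t <- choices T (drop a ys)) F s t.
Proof.
move=> ay; rewrite -{1}(cat_take_drop a ys) choices_cat.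
apply: eq_choices => s _ Es; apply: eq_choices => t _ _.
have Ea : size s = a by rewrite Es size_takel.
by rewrite take_size_cat // drop_size_cat.
Qed.

Definition arity_bounded T F := forall l, has (fun v => T < arity v)%N l -> F l = 0.

Lemma choices_bound T K ys F : (T <= K)%N -> arity_bounded T F ->
  \sum_(l <- choices K ys) F l = \sum_(l <- choices T ys) F l.
Proof.
move=> TK; elim: ys F => [|y ys IH] F F0; first by rewrite !choices_nil.
pose f c := \sum_(l <- choices K ys) F (@oel R P c (tag y) (tagged y c) :: l).
rewrite !choices_cons (@sum_ord_tail _ T.+1 K.+1 f) // => [|c Tc]; last first.
  by rewrite /f big1 // => l _; apply: F0; rewrite /= Tc.
by apply: eq_bigr => c _; apply: IH => l hl; apply: F0; rewrite /= hl orbT.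
Qed.

End Choices.

Section LinearOnOelts.
Variables (R : comPzRingType) (P : operad_data R) (V W : lmodType R).

Lemma linear_on_oelts_sum (k : oelt P -> V) n d (I : Type) (r : seq I) (f : I -> P n d) :
  linear_on_oelts k -> k (oel (\sum_(i <- r) f i)) = \sum_(i <- r) k (oel (f i)).
Proof. by move=> link; exact: (lin_sum (link n d)). Qed.

Lemma ocomponent_linear T e : linear_on_oelts (fun v : oelt P => ocomponent T e v).
Proof. by move=> *; exact: ocomponent_lin. Qed.

Lemma scan_zero N pos (x : oelt P) ys : scan N pos x ys (fun=> 0 : V) = 0.
Proof. by elim: N pos x ys => [|N IH] pos x [|y ys] //=; rewrite !IH addr0. Qed.

Lemma scan_sum N pos (x : oelt P) ys (I : Type) (r : seq I) (F : I -> oelt P -> V) :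
  scan N pos x ys (fun w => \sum_(i <- r) F i w) = \sum_(i <- r) scan N pos x ys (F i).
Proof.
elim: r => [|i r IH].
  by rewrite big_nil -[RHS](scan_zero N pos x ys); apply: scan_ext_all => w; rewrite big_nil.
by rewrite big_cons -IH -scan_add; apply: scan_ext_all => w; rewrite big_cons.
Qed.

Lemma linear_scan (g : V -> W) N pos (x : oelt P) ys F :
  (forall a u v, g (a *: u + v) = a *: g u + g v) ->
  g (scan N pos x ys F) = scan N pos x ys (fun w => g (F w)).
Proof.
move=> ling; elim: N pos x ys => [|N IH] pos x [|y ys] //=; first exact: lin_zero.
by rewrite -!IH lin_add.
Qed.

End LinearOnOelts.

Section TotalBraceRelation.
Variables (R : comPzRingType) (P : operad_data R).
Hypothesis laws : operad_laws P.

Definition tagged_oel (x : helt (total P)) (n : nat) : oelt P := oel (tagged x n).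

Lemma oelt_graft_bound (V : lmodType R) T (y : oelt P) t (k : oelt P -> V) :
  (forall v, (T < arity v)%N -> k v = 0) ->
  (T + size t < arity y)%N || has (fun v => T < arity v)%N t -> oelt_graft y t k = 0.
Proof.
move=> k0 big; rewrite -[RHS](scan_zero V (arity y) 0 y t); apply: scan_ext => // v st Ev _.
apply: k0; case/orP: big => [|ht]; first by lia.
suff : (T < arities t)%N by lia.
rewrite /arities; elim: t ht {st Ev} => //= w t IH; rewrite big_cons => /orP[|/IH]; lia.
Qed.

Lemma ocomponent_arity T e (v : oelt P) : arity v != T -> ocomponent T e v = 0.
Proof.
move=> ne; apply: (@component_neq _ _ (@op_fam R P) (T, e)); apply: contra ne => /eqP E.
by rewrite /arity E.
Qed.

(** The bounds on the arities in the definition of the brace may be enlarged: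
    a composite of arity T involves no y of arity above T, and no x of arity
    above T plus the number of ys. *)
Lemma brace_scanE (x : helt (total P)) ys e T K1 K2 :
  (T + size ys < K1)%N -> (T <= K2)%N ->
  brace x ys e T = \sum_(N < K1) \sum_(l <- choices K2 ys)
    oelt_graft (tagged_oel x N) l (ocomponent T e).
Proof.
move=> TK1 TK2.
have bound : forall v : oelt P, (T < arity v)%N -> ocomponent T e v = 0.
  by move=> v Tv; apply: ocomponent_arity; rewrite gtn_eqF.
transitivity (\sum_(N < (T + size ys).+1) \sum_(l <- choices T ys)
    oelt_graft (tagged_oel x N) l (ocomponent T e)).
  case: ys TK1 => [|y ys] _.
    rewrite addn0 big_ord_recr /= big1 ?add0r; last first.
      move=> N _; rewrite big_seq1 /oelt_graft scan_nil ocomponent_arity //.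
      by rewrite neq_ltn ltn_ord.
    rewrite big_seq1 /oelt_graft scan_nil /brace /ocomponent.
    case: x => d x; rewrite /tagged_oel /=.
    have [<-|ne] := eqVneq d e; first by rewrite !component_id.
    by rewrite !component_neq //=; apply: contra ne => /eqP[->].
  rewrite /brace; apply: eq_bigr => N _; apply: eq_choices => l _ _.
  exact: gamma_scanE.
rewrite -(@sum_ord_tail _ _ K1 (fun N => \sum_(l <- choices T ys)
    oelt_graft (tagged_oel x N) l (ocomponent T e))) //.
  apply: eq_bigr => N _; apply/esym/choices_bound => // l hl.
  by apply: oelt_graft_bound bound _; rewrite hl orbT.
move=> N TN; rewrite (@eq_choices _ _ _ _ _ _ (fun=> 0)) ?big1_eq // => l _ Es.
by apply: oelt_graft_bound bound _; rewrite Es /arity /= TN.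
Qed.

(** A functional that vanishes in arities above T sees the product element
    b(y; t) as a finite sum over the components of y and t. *)
Lemma sum_brace_components (V : lmodType R) (k : oelt P -> V) (y : helt (total P)) t T K1 K2 :
  linear_on_oelts k -> (forall v, (T < arity v)%N -> k v = 0) ->
  (T + size t < K1)%N -> (T <= K2)%N ->
  \sum_(a < T.+1) k (tagged_oel (hel (brace y t (tag y + total_degree t))) a)
  = \sum_(N < K1) \sum_(l <- choices K2 t) oelt_graft (tagged_oel y N) l k.
Proof.
move=> link k0 TK1 TK2; set e := tag y + total_degree t.
transitivity (\sum_(a < T.+1) \sum_(N < K1) \sum_(l <- choices K2 t)
    oelt_graft (tagged_oel y N) l (fun v => k (oel (ocomponent a e v)))).
  apply: eq_bigr => a _; rewrite /tagged_oel /=.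
  rewrite (@brace_scanE _ _ _ _ K1 K2); [|by have := ltn_ord a; lia..].
  rewrite linear_on_oelts_sum //; apply: eq_bigr => N _.
  rewrite linear_on_oelts_sum //; apply: eq_bigr => l _.
  exact: (@linear_scan R P (P a e) V (fun u => k (oel u)) _ _ _ _ _ (link a e)).
rewrite exchange_big; apply: eq_bigr => N _ /=.
rewrite exchange_big; apply: eq_choices => l El _ /=.
rewrite /oelt_graft -scan_sum; apply: scan_ext => // v _ _ Ev.
have {}Ev : degree v = e by rewrite Ev El.
have [Tv|vT] := ltnP T (arity v).
  rewrite k0 // big1 // => a _; rewrite ocomponent_arity; first exact: (lin_zero (link a e)).
  by have := ltn_ord a; lia.
rewrite (bigD1 (@Ordinal T.+1 (arity v) vT)) //= big1 ?addr0 => [|a ne].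
  by rewrite oel_ocomponent.
rewrite ocomponent_arity; first exact: (lin_zero (link a e)).
by apply: contra ne => /eqP Ea; apply/eqP/val_inj.
Qed.

Definition brace_graft (V : lmodType R) (y : helt (total P)) (t : seq (helt (total P)))
    (k : helt (total P) -> V) : V := k (hel (brace y t (tag y + total_degree t))).

Lemma brace_graft_lin (V : lmodType R) y t a (k k' : helt (total P) -> V) :
  brace_graft y t (fun v => a *: k v + k' v) = a *: brace_graft y t k + brace_graft y t k'.
Proof. by []. Qed.

Notation bweave := (weave (@tag _ _) (@tag _ _) (@brace_graft _)).
Notation oweave := (weave (@degree R P) (@degree R P) (@oelt_graft R P _)).

(** Choosing arities commutes with [weave]. The arities of the ys are allowed
    to be larger than those of the zs, because an operation loses up to
    size zs inputs when zs are inserted into it. *)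
Lemma weave_choices (V : lmodType R) T K ys zs (k : seq (oelt P) -> V) :
  omultilinear k -> arity_bounded T k -> (T + size zs <= K)%N ->
  \sum_(l' <- choices K ys) \sum_(l <- choices T zs) oweave l' l k
  = bweave ys zs (fun l => \sum_(v <- choices T l) k v).
Proof.
elim: ys zs k => [|y ys IH] zs k link k0 TK; first by rewrite choices_nil.
have tailP v (k' : seq (oelt P) -> V) : omultilinear k' -> arity_bounded T k' ->
    omultilinear (fun l => k' (v :: l)) /\ arity_bounded T (fun l => k' (v :: l)).
  move=> link' k0'; split=> [s t n d a x z|l hl]; first exact: (link' (v :: s)).
  by apply: k0'; rewrite /= hl orbT.
have here zs' (k' : seq (oelt P) -> V) :
    omultilinear k' -> arity_bounded T k' -> (T + size zs' <= K)%N ->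
    \sum_(N < K.+1) \sum_(l' <- choices K ys) \sum_(l <- choices T zs')
      weave_here (@degree R P) (@degree R P) (@oelt_graft R P _) (tagged_oel y N) l' l k'
    = weave_here (@tag _ _) (@tag _ _) (@brace_graft _) y ys zs'
        (fun l => \sum_(v <- choices T l) k' v).
  move=> link' k0' TK'.
  transitivity (\sum_(a < (size zs').+1)
      sgn (pairing (total_degree ys) (total_degree (take a zs'))) *:
      \sum_(N < K.+1) \sum_(l <- choices T (take a zs')) oelt_graft (tagged_oel y N) l
        (fun v => bweave ys (drop a zs') (fun l => \sum_(w <- choices T l) k' (v :: w)))).
    under eq_bigr => N _.
      under eq_bigr => l' _.
        under eq_choices => l El Es do rewrite /weave_here Es.
        rewrite exchange_big /=; over.
      rewrite exchange_big /=; over.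
    rewrite exchange_big /=; apply: eq_bigr => a _; rewrite scaler_sumr.
    apply: eq_bigr => N _; rewrite scaler_sumr.
    have aZ : (a <= size zs')%N by rewrite -ltnS.
    under eq_bigr => l' _ do rewrite (choices_take_drop T (fun s t =>
      sgn (pairing (odegree l') (odegree s)) *: oelt_graft (tagged_oel y N) s (fun v =>
        oweave l' t (fun l => k' (v :: l)))) aZ).
    rewrite exchange_big /=; apply: eq_choices => s Es _.
    transitivity (\sum_(l' <- choices K ys) sgn (pairing (total_degree ys) (odegree s)) *:
      oelt_graft (tagged_oel y N) s (fun v =>
        \sum_(t <- choices T (drop a zs')) oweave l' t (fun l => k' (v :: l)))).
      apply: eq_choices => l' El' _; rewrite El' -scaler_sumr; congr (_ *: _).
      by rewrite /oelt_graft scan_sum.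
    rewrite -scaler_sumr -Es; congr (_ *: _); rewrite /oelt_graft -scan_sum.
    apply: scan_ext_all => v; have [link'v k0'v] := tailP v k' link' k0'.
    by rewrite IH // (leq_trans _ TK') // leq_add2l size_drop leq_subr.
  apply: eq_bigr => a _; congr (_ *: _).
  rewrite -(@sum_brace_components _ _ _ _ T).
  - rewrite /brace_graft -(weave_sum _ _ (@brace_graft_lin _)).
    by apply: weave_ext => l _; rewrite choices_cons.
  - move=> n d b u v; rewrite -(weave_lin _ _ (@brace_graft_lin _)).
    apply: weave_ext => l _; rewrite scaler_sumr -big_split; apply: eq_bigr => w _.
    exact: (link' [::]).
  - move=> v Tv; rewrite -[RHS](weave0 (@tag _ _) (@tag _ _) (@brace_graft_lin _) ys (drop a zs')).
    by apply: weave_ext => l _; rewrite big1 // => w _; apply: k0'; rewrite /= Tv.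
  - have aZ : (a <= size zs')%N by rewrite -ltnS.
    by rewrite size_takel // ltnS (leq_trans _ TK') // leq_add2l.
  - exact: leqnn.
elim: zs k link k0 TK => [|z zs IHz] k link k0 TK.
  rewrite weave_cons_nil -here // choices_cons; apply: eq_bigr => N _.
  by apply: eq_bigr => l' _; rewrite !choices_nil weave_cons_nil.
have TK0 : (T + size zs <= K)%N by apply: leq_trans TK; rewrite leq_add2l.
rewrite weave_cons -here //.
transitivity (\sum_(c < T.+1) sgn (pairing (total_degree (y :: ys)) (tag z)) *:
   \sum_(l' <- choices K (y :: ys)) \sum_(l <- choices T zs)
      oweave l' l (fun l => k (tagged_oel z c :: l))
   + \sum_(N < K.+1) \sum_(l' <- choices K ys) \sum_(l <- choices T (z :: zs))
      weave_here (@degree R P) (@degree R P) (@oelt_graft R P _) (tagged_oel y N) l' l k).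
  under [X in _ = X + _]eq_bigr => c _ do rewrite scaler_sumr.
  rewrite [X in _ = X + _]exchange_big choices_cons [X in _ = X + _]choices_cons -big_split.
  apply: eq_bigr => N _ /=; rewrite -big_split; apply: eq_choices => l' El' _ /=.
  rewrite !choices_cons -big_split; apply: eq_bigr => c _ /=.
  rewrite scaler_sumr -big_split; apply: eq_choices => l _ _ /=.
  by rewrite [LHS]weave_cons total_degree_cons -El'.
congr (_ + _); rewrite -scaler_sumr total_degree_cons; congr (_ *: _).
transitivity (\sum_(c < T.+1) bweave (y :: ys) zs (fun l =>
    \sum_(v <- choices T l) k (tagged_oel z c :: v))).
  apply: eq_bigr => c _; have [linkc k0c] := tailP (tagged_oel z c) k link k0.
  exact: IHz.
rewrite -(weave_sum _ _ (@brace_graft_lin _)).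
by apply: weave_ext => l _; rewrite choices_cons.
Qed.

(** The brace relation in the product of all arities: expand every element into
    components, apply [scan_scan] and collect the terms by [weave_choices]. *)
Lemma brace_of_brace_component (x : helt (total P)) ys zs e T :
  brace (hel (brace x ys (tag x + total_degree ys))) zs e T
  = bweave ys zs (fun l => brace x l e T).
Proof.
set n := (size ys + size zs)%N.
pose k w := \sum_(l <- choices T zs) oelt_graft w l (ocomponent (P := P) T e).
have link : linear_on_oelts k.
  move=> m d a u v; rewrite /k scaler_sumr -big_split; apply: eq_bigr => l _.
  exact: (scan_linl _ _ _ (@ocomponent_linear _ P T e)).
have k0 v : (T + size zs < arity v)%N -> k v = 0.
  move=> Tv; rewrite /k (@eq_choices _ _ _ _ _ _ (fun=> 0)) ?big1_eq // => l _ Es.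
  apply: (@oelt_graft_bound _ T); last by rewrite Es Tv.
  by move=> w Tw; apply: ocomponent_arity; rewrite gtn_eqF.
rewrite (@brace_scanE _ _ _ _ (T + size zs).+1 T) //.
transitivity (\sum_(N < (T + size zs + n).+1) \sum_(l' <- choices (T + size zs) ys)
    oelt_graft (tagged_oel x N) l' k).
  rewrite -(@sum_brace_components _ k x ys (T + size zs)) //.
  by rewrite ltnS leq_add2l leq_addr.
transitivity (\sum_(N < (T + size zs + n).+1) bweave ys zs (fun l =>
    \sum_(v <- choices T l) oelt_graft (tagged_oel x N) v (ocomponent T e))).
  apply: eq_bigr => N _.
  rewrite -(@weave_choices _ T (T + size zs) ys zs (fun v => oelt_graft (tagged_oel x N) v _)) //.
  - apply: eq_bigr => l' _; rewrite /oelt_graft scan_sum; apply: eq_bigr => l _.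
    rewrite -(scan_scan laws) //; last exact: ocomponent_linear.
    by apply: scan_ext_all => w; rewrite /scan_after subn0.
  - exact: (scan_linr _ _ _ (@ocomponent_linear _ P T e)).
  - move=> l hl; apply: (@oelt_graft_bound _ T); last by rewrite hl orbT.
    by move=> w Tw; apply: ocomponent_arity; rewrite gtn_eqF.
rewrite -(weave_sum _ _ (@brace_graft_lin _)).
apply: weave_ext => l sl; rewrite (@brace_scanE _ _ _ _ (T + size zs + n).+1 T) //.
by rewrite ltnS -addnA leq_add2l; case/andP: sl => _ sl; apply: leq_trans sl (leq_addl _ _).
Qed.

End TotalBraceRelation.

(** * Braces in an endomorphism operad *)
Section EndoEvaluation.
Variables (R : comPzRingType) (A : bigraded R).

(** Unlike the coercion of an element of endo A n d to a function, this makes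
    sense for operations whose arity is not known beforehand. *)
Definition oeval (f : oelt (endo A)) (zs : seq (helt A)) (e : bidegree) : A e :=
  (tagged f : mmap A (arity f) (degree f)) zs e.

Lemma oeval_size f zs e : size zs != arity f -> oeval f zs e = 0.
Proof. by move=> ne; rewrite /oeval mval_supp // negb_and ne. Qed.

Lemma oeval_ocomponent n d f zs e :
  size zs = n -> degree f = d -> (@ocomponent R (endo A) n d f : mmap A n d) zs e = oeval f zs e.
Proof.
move=> Ez Ed; have [En|ne] := eqVneq (arity f) n; last first.
  by rewrite ocomponent_arity // oeval_size // Ez eq_sym.
by rewrite -[f in RHS](oel_ocomponent En Ed).
Qed.

Definition feed (g : oelt (endo A)) (zs : seq (helt A)) : helt A :=
  let ys := take (arity g) zs in hel (oeval g ys (degree g + total_degree ys)).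

Fixpoint feed_all (l : seq (oelt (endo A))) (zs : seq (helt A)) : seq (helt A) :=
  if l is g :: l' then feed g zs :: feed_all l' (drop (arity g) zs) else zs.

(** The Koszul rule for the tensor product of the maps in l, applied to zs. *)
Fixpoint feed_exponent (l : seq (oelt (endo A))) (zs : seq (helt A)) : int :=
  if l is g :: l' then
    pairing (odegree l') (total_degree (take (arity g) zs))
    + feed_exponent l' (drop (arity g) zs)
  else 0.

Lemma oeval_ocomp r f g ws zs e : size ws = r ->
  oeval (ocomp r f g) (ws ++ zs) e
  = sgn (pairing (degree g) (total_degree ws)) *:
      oeval f (ws ++ feed g zs :: drop (arity g) zs) e.
Proof.
move=> <-; rewrite /oeval /= /mmap_comp_val take_size_cat // drop_size_cat //.
by rewrite addnC -drop_drop drop_size_cat.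
Qed.

Lemma arity_gamma_from_ge pos (f : oelt (endo A)) l :
  (pos + size l <= arity f)%N -> (pos <= arity (gamma_from pos f l))%N.
Proof.
elim: l pos f => [|g l IH] pos f /= sl; first by rewrite addn0 in sl.
by apply: leq_trans (IH _ _ _); rewrite ?leq_addr // arity_ocomp; lia.
Qed.

(** If zs is too short for the next g, both sides vanish: on the left for
    reasons of arity, on the right because f has an argument 0. *)
Lemma oeval_gamma_from pos f l ws zs e :
  size ws = pos -> (pos + size l <= arity f)%N ->
  oeval (gamma_from pos f l) (ws ++ zs) e
  = sgn (pairing (odegree l) (total_degree ws) + feed_exponent l zs) *:
      oeval f (ws ++ feed_all l zs) e.
Proof.
elim: l pos f ws zs => [|g l IH] pos f ws zs Ews sl /=.
  by rewrite /odegree big_nil pairing0l addr0 scale1r.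
have [ag|ag] := leqP (arity g) (size zs); last first.
  rewrite oeval_size; last first.
    rewrite size_cat Ews; apply/eqP => E.
    have := @arity_gamma_from_ge (pos + arity g) (ocomp pos f g) l.
    by rewrite arity_ocomp -E; move: sl => /=; lia.
  rewrite {1}/feed (oeval_size (f := g)); last by rewrite take_oversize ?(ltnW ag) // neq_ltn ag.
  by rewrite /oeval mval_lin0 scaler0.
rewrite -{1}(cat_take_drop (arity g) zs) catA IH; first last.
- by rewrite arity_ocomp; move: sl => /=; lia.
- by rewrite size_cat size_takel // Ews.
rewrite -catA oeval_ocomp // scalerA -sgnD.
have Et : size (take (arity g) zs) = arity g by rewrite size_takel.
rewrite /feed take_size_cat // drop_size_cat //; congr (sgn _ *: _).
by rewrite total_degree_cat /odegree big_cons pairingDl pairingDr; ring.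
Qed.

End EndoEvaluation.

Section Insertions.
Variables (R : comPzRingType) (P : operad_data R) (V : zmodType).

Lemma eq_insertions N (ys : seq (oelt P)) (F G : seq (oelt P) -> V) :
  (forall l, size l = N -> odegree l = odegree ys -> F l = G l) ->
  \sum_(l <- insertions N ys) F l = \sum_(l <- insertions N ys) G l.
Proof.
elim: N ys F G => [|N IH] [|y ys] F G FG /=.
- by rewrite !big_seq1 FG.
- by rewrite !big_nil.
- rewrite !big_map; apply: IH => l sl El; apply: FG; rewrite /= ?sl //.
  by rewrite -El /odegree big_cons add0r.
- rewrite !big_cat !big_map; congr (_ + _); apply: IH => l sl El; apply: FG;
    rewrite /= ?sl //.
    by rewrite -El /odegree !big_cons add0r.
  by rewrite /odegree !big_cons; congr (_ + _).
Qed.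

End Insertions.

Section EndoBraces.
Variables (R : comPzRingType) (A : bigraded R) (V : lmodType R).
Implicit Types (G : helt (total (endo A))) (k : nat -> seq (helt A) -> V).

Definition eval_graft (G : helt (total (endo A))) (t : seq (helt A)) (k : helt A -> V) : V :=
  k (hel ((tagged G (size t) : mmap A (size t) (tag G)) t (tag G + total_degree t))).

Lemma feed_oone (z : helt A) zs : feed (oone (endo A)) (z :: zs) = z.
Proof.
rewrite /feed /oeval /= take0.
have -> : degree (oone (endo A)) + total_degree [:: z] = tag z.
  by rewrite /total_degree big_seq1 add0r.
by case: z => d z /=; rewrite component_id.
Qed.

Lemma feed_oone_nil : feed (oone (endo A)) [::] = hel (0 : A (0 + @total_degree R A [::])).
Proof. by []. Qed.

Notation eweave := (weave (@tag _ _) (@tag _ _) eval_graft).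

(** Summing over the arity N of the outer map, the arities of the Gs and the
    positions of the Gs among N inputs amounts to summing over the ways of
    distributing zs: a distribution determines these numbers and is determined
    by them, and the choices that do not match the length of zs contribute 0.
    The proof reads the inputs of the outer map from left to right; an input
    filled with the unit leaves the next z alone. *)
Lemma sum_feed_weave n Gs zs k K :
  (forall N l, size l != N -> k N l = 0) ->
  (forall N s t d, k N (s ++ hel (0 : A d) :: t) = 0) ->
  (size zs + size Gs < K)%N -> (size zs <= n)%N ->
  \sum_(N < K) \sum_(gs <- choices n Gs) \sum_(l <- insertions N gs)
    sgn (feed_exponent l zs) *: k N (feed_all l zs)
  = eweave Gs zs (fun l => k (size l) l).
Proof.
elim: Gs zs k K => [|G Gs IH].
  elim=> [|z zs IHz] k [|K] //= kN k0 zK zn; rewrite big_ord_recl /=.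
    rewrite !big_seq1 /= scale1r big1 ?addr0 // => N _.
    rewrite !big_seq1 big_map big1 // => l _ /=.
    by rewrite feed_oone_nil (k0 _ [::]) scaler0.
  rewrite !big_seq1 kN // scaler0 add0r.
  etransitivity; last first.
    apply: (IHz (fun N l => k N.+1 (z :: l)) K) => //; last exact: ltnW.
      by move=> N l ne; apply: kN.
    by move=> N s t d; apply: (k0 _ (z :: s)).
  apply: eq_bigr => N _; rewrite !big_seq1 big_map; apply: eq_insertions => l _ El /=.
  by rewrite feed_oone El {1}/odegree big_nil pairing0l add0r drop0.
have here zs k K : (forall N l, size l != N -> k N l = 0) ->
    (forall N s t d, k N (s ++ hel (0 : A d) :: t) = 0) ->
    (size zs + size Gs < K)%N -> (size zs <= n)%N ->
    \sum_(N < K) \sum_(c < n.+1) \sum_(gs <- choices n Gs) \sum_(l <- insertions N gs)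
      sgn (feed_exponent (tagged_oel G c :: l) zs) *: k N.+1 (feed_all (tagged_oel G c :: l) zs)
    = weave_here (@tag _ _) (@tag _ _) eval_graft G Gs zs (fun l => k (size l) l).
  move=> kN k0 zK zn; rewrite exchange_big /=.
  pose f c := \sum_(N < K) \sum_(gs <- choices n Gs) \sum_(l <- insertions N gs)
      sgn (feed_exponent (tagged_oel G c :: l) zs) *: k N.+1 (feed_all (tagged_oel G c :: l) zs).
  rewrite (@sum_ord_tail _ (size zs).+1 n.+1 f) // => [|c zc]; last first.
    rewrite /f !big1 // => N _; rewrite big1 // => gs _; rewrite big1 // => l _ /=.
    rewrite {1}/feed (oeval_size (f := tagged_oel G c)); last first.
      by rewrite take_oversize ?(ltnW zc) // neq_ltn zc.
    by rewrite (k0 _ [::]) scaler0.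
  apply: eq_bigr => a _; have aZ : (a <= size zs)%N by rewrite -ltnS.
  have sa : size (take a zs) = a by rewrite size_takel.
  transitivity (sgn (pairing (total_degree Gs) (total_degree (take a zs))) *:
    \sum_(N < K) \sum_(gs <- choices n Gs) \sum_(l <- insertions N gs)
      sgn (feed_exponent l (drop a zs)) *:
        k N.+1 (feed (tagged_oel G a) zs :: feed_all l (drop a zs))).
    rewrite scaler_sumr; apply: eq_bigr => N _.
    rewrite scaler_sumr; apply: eq_choices => gs Egs _.
    rewrite scaler_sumr; apply: eq_insertions => l _ El /=.
    by rewrite El Egs sgnD scalerA.
  congr (_ *: _); have -> : feed (tagged_oel G a) zs
      = hel ((tagged G (size (take a zs)) : mmap A (size (take a zs)) (tag G))
          (take a zs) (tag G + total_degree (take a zs))) by rewrite sa.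
  apply: (IH (drop a zs) (fun N l => k N.+1 (_ :: l)) K).
  - by move=> N l ne; apply: kN.
  - by move=> N s t d; apply: (k0 _ (_ :: s)).
  - by rewrite size_drop; apply: leq_ltn_trans zK; rewrite leq_add2r leq_subr.
  - by rewrite size_drop; apply: leq_trans zn; rewrite leq_subr.
have split_sum zs k K : (forall N s t d, k N (s ++ hel (0 : A d) :: t) = 0) ->
    \sum_(N < K.+1) \sum_(gs <- choices n (G :: Gs)) \sum_(l <- insertions N gs)
      sgn (feed_exponent l zs) *: k N (feed_all l zs)
  = (if zs is z :: zs' then
       sgn (pairing (tag G + total_degree Gs) (tag z)) *:
       \sum_(N < K) \sum_(gs <- choices n (G :: Gs)) \sum_(l <- insertions N gs)
         sgn (feed_exponent l zs') *: k N.+1 (z :: feed_all l zs')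
     else 0)
    + \sum_(N < K) \sum_(c < n.+1) \sum_(gs <- choices n Gs) \sum_(l <- insertions N gs)
      sgn (feed_exponent (tagged_oel G c :: l) zs) *: k N.+1 (feed_all (tagged_oel G c :: l) zs).
  move=> k0; rewrite big_ord_recl choices_cons big1 ?add0r => [|c _]; last first.
    by rewrite big1 // => gs _; rewrite big_nil.
  transitivity (\sum_(N < K) \sum_(gs <- choices n (G :: Gs)) \sum_(l <- insertions N gs)
       sgn (feed_exponent (oone (endo A) :: l) zs) *: k N.+1 (feed_all (oone (endo A) :: l) zs)
    + \sum_(N < K) \sum_(c < n.+1) \sum_(gs <- choices n Gs) \sum_(l <- insertions N gs)
      sgn (feed_exponent (tagged_oel G c :: l) zs) *: k N.+1 (feed_all (tagged_oel G c :: l) zs)).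
    rewrite -big_split; apply: eq_bigr => N _ /=.
    rewrite !choices_cons -big_split; apply: eq_bigr => c _ /=.
    rewrite -big_split; apply: eq_choices => gs _ _ /=.
    by rewrite big_cat !big_map.
  congr (_ + _); case: zs => [|z zs].
    rewrite big1 // => N _; rewrite big1 // => gs _; rewrite big1 // => l _.
    by rewrite /= feed_oone_nil (k0 _ [::]) scaler0.
  rewrite scaler_sumr; apply: eq_bigr => N _.
  rewrite scaler_sumr; apply: eq_choices => gs Egs _.
  rewrite scaler_sumr; apply: eq_insertions => l _ El.
  rewrite /= feed_oone take0 drop0 sgnD scalerA El Egs total_degree_cons.
  by rewrite /total_degree big_seq1.
elim=> [|z zs IHz] k [|K] // kN k0 zK zn.
  by rewrite split_sum // weave_cons_nil add0r here // -ltnS.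
rewrite split_sum // weave_cons here //; last by move: zK; rewrite /= addnS ltnS.
congr (_ *: _ + _).
apply: (IHz (fun N l => k N.+1 (z :: l)) K) => //; last exact: ltnW.
  by move=> N l ne; apply: kN.
by move=> N s t d; apply: (k0 _ (z :: s)).
Qed.

End EndoBraces.

Section EndoBraceEvaluation.
Variables (R : comPzRingType) (A : bigraded R).

Notation eweave := (weave (@tag _ _) (@tag _ _) (@eval_graft R A _)).

Lemma mval_sum n d zs e (I : Type) (r : seq I) (F : I -> mmap A n d) :
  (\sum_(i <- r) F i : mmap A n d) zs e = \sum_(i <- r) F i zs e.
Proof. by elim: r => [|i r IH]; rewrite ?big_nil // !big_cons -IH. Qed.

Lemma endo_braceE (F : helt (total (endo A))) Gs zs n d e :
  size zs = n -> d = tag F + total_degree Gs ->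
  (brace F Gs d n : mmap A n _) zs e
  = eweave Gs zs (fun l => (tagged F (size l) : mmap A (size l) _) l e).
Proof.
move=> Ezs ->; case: Gs => [|G Gs].
  have -> : tag F + @total_degree R (total (endo A)) [::] = tag F :> bidegree.
    by rewrite /total_degree big_nil addr0.
  by case: F => d' F; rewrite /brace component_id weave_nil Ezs.
set Gs' := G :: Gs; set e' := tag F + _.
rewrite /brace -/Gs' mval_sum.
rewrite -(@sum_feed_weave _ _ _ n Gs' zs (fun N l => oeval (tagged_oel F N) l e) (n + size Gs').+1).
- apply: eq_bigr => N _; rewrite mval_sum; apply: eq_choices => gs Egs _.
  rewrite /obrace mval_sum; apply: eq_insertions => l El Edl.
  rewrite oeval_ocomponent //; last by rewrite degree_gamma_from /e' -Egs -Edl.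
  rewrite -[zs in LHS]cat0s (@oeval_gamma_from _ _ 0 _ _ [::]) //; last by rewrite El.
  by rewrite /total_degree big_nil pairing0r add0r.
- by move=> N l ne; apply: oeval_size.
- by move=> N s t c; apply: mval_lin0.
- by rewrite Ezs.
- by rewrite Ezs.
Qed.

End EndoBraceEvaluation.

(** * Braces and morphisms of operads *)
Section OperadMorphism.
Variables (R : comPzRingType) (P Q : operad_data R).
Variable phi : forall n d, P n d -> Q n d.
Hypothesis phi_lin : forall n d a (x y : P n d), phi (a *: x + y) = a *: phi x + phi y.

Definition oelt_map (x : oelt P) : oelt Q :=
  @oel R Q (arity x) (degree x) (phi (tagged x : P (arity x) (degree x))).

Definition total_map (x : helt (total P)) : helt (total Q) :=
  @hel _ _ (total Q) (tag x) (fun n => phi (tagged x n)).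

Hypothesis oelt_map_one : oelt_map (oone P) = oone Q.
Hypothesis oelt_map_comp : forall r x y, (r < arity x)%N ->
  oelt_map (ocomp r x y) = ocomp r (oelt_map x) (oelt_map y).

Lemma ocomponent_oelt_map T e x : ocomponent T e (oelt_map x) = phi (ocomponent T e x).
Proof.
case: x => -[n d] x; have [[<- <-]|ne] := eqVneq (n, d) (T, e).
  by rewrite /ocomponent !component_id.
have phi0 : phi (0 : P T e) = 0 := lin_zero (phi_lin (n := T) (d := e)).
by rewrite /ocomponent (@component_neq _ _ (@op_fam R P)) ?(@component_neq _ _ (@op_fam R Q)).
Qed.

Lemma gamma_from_oelt_map pos x l : (pos + size l <= arity x)%N ->
  gamma_from pos (oelt_map x) (map oelt_map l) = oelt_map (gamma_from pos x l).
Proof.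
elim: l pos x => [|y l IH] pos x //= sl; rewrite -oelt_map_comp; last by lia.
by rewrite -[arity (oelt_map y)]/(arity y) IH // arity_ocomp; lia.
Qed.

Lemma insertions_oelt_map (V : zmodType) N ys (F : seq (oelt Q) -> V) :
  \sum_(l <- insertions N (map oelt_map ys)) F l = \sum_(l <- insertions N ys) F (map oelt_map l).
Proof.
elim: N ys F => [|N IH] [|y ys] F /=; rewrite ?big_seq1 ?big_nil //.
  by rewrite !big_map -oelt_map_one (IH [::] (fun l => F (oelt_map (oone P) :: l))).
rewrite !big_cat !big_map /= -oelt_map_one.
by rewrite (IH (y :: ys) (fun l => F (oelt_map (oone P) :: l))) (IH ys (fun l => F (oelt_map y :: l))).
Qed.

Lemma choices_total_map (V : zmodType) T ys (F : seq (oelt Q) -> V) :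
  \sum_(l <- choices T (map total_map ys)) F l = \sum_(l <- choices T ys) F (map oelt_map l).
Proof.
elim: ys F => [|y ys IH] F; first by rewrite !choices_nil.
by rewrite map_cons !choices_cons; apply: eq_bigr => c _; rewrite IH.
Qed.

Lemma obrace_oelt_map x ys T e : obrace (oelt_map x) (map oelt_map ys) T e = phi (obrace x ys T e).
Proof.
rewrite /obrace insertions_oelt_map (lin_sum (phi_lin (n := T) (d := e))).
apply: eq_insertions => l sl _.
by rewrite /gamma gamma_from_oelt_map ?ocomponent_oelt_map // sl.
Qed.

Lemma brace_total_map x ys e T : brace (total_map x) (map total_map ys) e T = phi (brace x ys e T).
Proof.
have linT := phi_lin (n := T) (d := e).
case: ys => [|y ys].
  case: x => d x; rewrite /brace /=; have [<-|ne] := eqVneq d e.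
    by rewrite !component_id.
  by rewrite !component_neq //; rewrite (lin_zero linT).
rewrite map_cons /brace -map_cons size_map (lin_sum linT).
apply: eq_bigr => N _; rewrite (lin_sum linT) choices_total_map.
by apply: eq_choices => l _ _; rewrite -obrace_oelt_map.
Qed.

End OperadMorphism.

(** * The suspension isomorphism sigma_bar *)
Section SigmaBarMorphism.
Variables (R : comPzRingType) (B : bigraded R).

Lemma sigma_bar_linear n d a (F G : endo B n d) :
  sigma_bar (a *: F + G) = a *: sigma_bar F + sigma_bar G :> susp (endo (shift B)) n d.
Proof.
apply: mmapP => xs e; rewrite /= /sigma_bar_val /= scalerDr !scalerA.
by congr (_ *: _ + _); exact: mulrC.
Qed.

Lemma component_unshift e (x : helt (shift B)) :
  component (e - bideg 0 1) (unshift x) = component e x.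
Proof.
case: x => d x; have [<-|ne] := eqVneq d e.
  by rewrite [RHS]component_id /unshift /= component_id.
rewrite [RHS]component_neq // [LHS]component_neq //=.
by apply: contra ne => /eqP/addIr->.
Qed.

Notation sigma := (@sigma_bar R B).

Lemma oelt_map_sigma_one : oelt_map sigma (oone (endo B)) = oone (susp (endo (shift B))).
Proof.
rewrite /oelt_map /oone /=; congr (@oel _ (susp _)); apply: mmapP => xs e.
have [sx|sx] := eqVneq (size xs) 1%N; last first.
  by rewrite !mval_supp // (negbTE sx).
rewrite [RHS](@oeval_ocomponent _ _ _ _ (oone (endo (shift B))) _ _ sx) //.
case: xs sx => [|x [|]] //= _; rewrite /sigma_bar_val /= mul0r addr0 scale1r.
exact: component_unshift.
Qed.

Lemma shift_exponent_cat (s t : seq (helt B)) :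
  shift_exponent (s ++ t)
  = shift_exponent s + (size t)%:Z * (total_degree s).2 + shift_exponent t.
Proof.
elim: s => [|x s IH] /=; first by rewrite /total_degree big_nil mulr0 !add0r.
rewrite IH size_cat PoszD total_degree_cons /=; ring.
Qed.

Lemma mval_scale n p (f : mmap B n p) s t d a (x : B d) e :
  f (s ++ hel (a *: x) :: t) e = a *: f (s ++ hel x :: t) e.
Proof. exact: (lin_scale (fun b u v => mval_lin f s t b u v e)). Qed.

(** Cut the arguments into those before, inside and after G. The Koszul sign of
    S^{(x) n} then splits accordingly, and what is left over is the sign
    defining the composition of the suspension, up to an even exponent. *)
Lemma sigma_bar_comp n m p q r (F : endo B n p) (G : endo B m q) : (r < n)%N ->
  sigma (mmap_comp r F G) = @susp_comp R (endo (shift B)) n m p q r (sigma F) (sigma G).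
Proof.
move=> rn; apply: mmapP => xs e.
have [sx|sx] := eqVneq (size xs) (n + m).-1; last first.
  by rewrite !mval_supp // (negbTE sx).
rewrite /susp_comp.
set w := oel _; set c := sgn (_ + _ + _).
transitivity (c *: oeval w xs e); last first.
  rewrite -(@oeval_ocomponent _ _ (n + m).-1 (p + q - bideg 0 ((n + m).-1%:Z - 1))) //.
  rewrite /w /degree /= addrACA -opprD; congr (_ - (_, _)) => /=; lia.
have [s [mid [t [Exs ss sm st]]]] : exists s mid t,
    [/\ xs = s ++ mid ++ t, size s = r, size mid = m & (n = r + (size t).+1)%N].
  exists (take r xs), (take m (drop r xs)), (drop m (drop r xs)).
  rewrite !cat_take_drop !size_drop !size_takel ?size_drop; last by lia.
    by split=> //; lia.
  by lia.
rewrite {xs sx}Exs /w /oeval /= /mmap_comp_val /= /sigma_bar_val /=.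
rewrite addnC -!drop_drop drop_size_cat // [take r (s ++ _)]take_size_cat //.
rewrite take_size_cat // drop_size_cat // !map_cat map_cons.
set s' := map _ s; set mid' := map _ mid; set t' := map _ t.
have ss' : size s' = r by rewrite size_map.
have sm' : size mid' = m by rewrite size_map.
rewrite /mmap_comp_val addnC -drop_drop drop_size_cat // take_size_cat // take_size_cat //.
rewrite drop_size_cat //; set d := _ + _ - bideg 0 1.
rewrite -[unshift _]/(hel (sgn (shift_exponent mid') *: (G : mmap B m q) mid' d)).
rewrite mval_scale !shift_exponent_cat /= !scalerA.
have Ed : d = q + total_degree mid'.
  rewrite total_degree_unshift sm /d; move: (total_degree mid) => z.
  rewrite -!addrA; congr (_ + _).
  rewrite addrCA; congr (_ + _); rewrite -opprD.
  by congr (- (_, _)); rewrite /= subrK.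
rewrite Ed; congr (_ *: _); rewrite /c -!sgnD.
set M := q + total_degree mid'.
have Es : total_degree s = total_degree s' + bideg 0 r%:Z.
  by rewrite total_degree_unshift ss subrK.
have Em : total_degree mid = total_degree mid' + bideg 0 m%:Z.
  by rewrite total_degree_unshift sm subrK.
have st' : size t' = size t by rewrite size_map.
rewrite Es Em size_cat sm' st' /pairing /= -[(size t).+1]add1n !PoszD st.
apply/esym/(@eq_sgn _ _ _ ((r + size t)%:Z * q.2 - (m%:Z - 1) * (total_degree s').2)).
rewrite -[(size t).+1]add1n !PoszD.

ring.
Qed.

Lemma oelt_map_sigma_comp r (x y : oelt (endo B)) : (r < arity x)%N ->
  oelt_map sigma (ocomp r x y) = ocomp r (oelt_map sigma x) (oelt_map sigma y).
Proof.
by move=> rn; rewrite /oelt_map; congr (@oel _ (susp _)); exact: sigma_bar_comp.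
Qed.

Lemma brace_sigma (F : helt (total (endo B))) Gs e n :
  brace (total_map sigma F) (map (total_map sigma) Gs) e n = sigma (brace F Gs e n).
Proof.
exact: (brace_total_map sigma_bar_linear oelt_map_sigma_one oelt_map_sigma_comp).
Qed.

End SigmaBarMorphism.

(** * The map Phi' commutes with braces *)
Lemma weave_map (R : comPzRingType) (V W : lmodType R) (Y Y' Z : Type)
    (f : Y -> Y') (g : V -> W) (dY : Y -> bidegree) (dY' : Y' -> bidegree) (dZ : Z -> bidegree)
    (graft : Y -> seq Z -> (Z -> W) -> W) (graft' : Y' -> seq Z -> (Z -> V) -> V)
    ys zs (k : seq Z -> V) :
  (forall a x y, g (a *: x + y) = a *: g x + g y) ->
  (forall y, dY' (f y) = dY y) ->
  (forall y t j, g (graft' (f y) t j) = graft y t (fun v => g (j v))) ->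
  g (weave dY' dZ graft' (map f ys) zs k) = weave dY dZ graft ys zs (fun l => g (k l)).
Proof.
move=> g_lin df graftf.
have dsf s : degree_sum dY' (map f s) = degree_sum dY s.
  by rewrite /degree_sum big_map; apply: eq_bigr => y _; exact: df.
elim: ys zs k => [|y ys IH] zs k //.
have here zs' k' : g (weave_here dY' dZ graft' (f y) (map f ys) zs' k')
    = weave_here dY dZ graft y ys zs' (fun l => g (k' l)).
  rewrite (lin_sum g_lin); apply: eq_bigr => a _.
  rewrite (lin_scale g_lin) dsf graftf; congr (_ *: _).
  by apply: graft_ext => v; rewrite IH.
elim: zs k => [|z zs IHz] k; first by rewrite map_cons !weave_cons_nil here.
rewrite map_cons !weave_cons (lin_add g_lin) (lin_scale g_lin) here -map_cons.
by rewrite IHz df dsf.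
Qed.

Section WeaveOne.
Variables (R : comPzRingType) (V : lmodType R) (Y Z : Type).
Variables (dY : Y -> bidegree) (dZ : Z -> bidegree).
Variable graft : Y -> seq Z -> (Z -> V) -> V.
Hypothesis graft_lin : forall y t a k k',
  graft y t (fun v => a *: k v + k' v) = a *: graft y t k + graft y t k'.

Lemma weave_eq0 ys zs k :
  (forall l, (size ys <= size l)%N -> k l = 0) -> weave dY dZ graft ys zs k = 0.
Proof.
move=> k0; rewrite -(weave0 dY dZ graft_lin ys zs); apply: weave_ext => l /andP[sl _].
exact: k0.
Qed.

Lemma weave_single y zs k :
  (forall l, (1 < size l)%N -> k l = 0) ->
  weave dY dZ graft [:: y] zs k = graft y zs (fun v => k [:: v]).
Proof.
move=> k0; have here : weave_here dY dZ graft y [::] zs k = graft y zs (fun v => k [:: v]).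
  rewrite /weave_here big_ord_recr /= big1 => [|a _].
    by rewrite add0r take_size drop_size /degree_sum big_nil pairing0l scale1r.
  rewrite (@graft_ext _ _ _ _ graft _ _ _ (fun=> 0)) => [|v].
    have := graft_lin y (take a zs) (-1) (fun=> 0) (fun=> 0).
    by under eq_fun do rewrite addr0 scaler0; rewrite scaleN1r addNr => ->; rewrite scaler0.
  by apply: k0; rewrite /= size_drop ltnS subn_gt0.
case: zs here => [|z zs] here; first by rewrite weave_cons_nil here.
rewrite weave_cons here weave_eq0 ?scaler0 ?add0r // => l sl.
exact: k0.
Qed.

End WeaveOne.

Lemma brace_mapE (R : comPzRingType) (P : operad_data R) d (x : total P d) n zs e :
  size zs = n -> (brace_map x n : mmap (total P) n d) zs e = brace (hel x) zs e.
Proof. by move=> <-; rewrite /= /brace_map_val eqxx. Qed.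

Section PhiPrime.
Variables (R : comPzRingType) (P : operad_data R).
Hypothesis laws : operad_laws P.
Local Notation A := (total P).

Definition Phi' (x : helt A) : helt (total (endo A)) :=
  @hel _ _ (total (endo A)) (tag x) (brace_map (tagged x)).

Lemma brace_map_linear d n a (x y : A d) :
  brace_map (a *: x + y) n = a *: brace_map x n + brace_map y n.
Proof.
apply: mmapP => zs e; rewrite /= /brace_map_val; case: eqP => _.
  exact: brace_linl.
by rewrite scaler0 addr0.
Qed.

Lemma total_degree_Phi' ys : total_degree (map Phi' ys) = total_degree ys.
Proof. by rewrite /total_degree big_map. Qed.

Notation bweave := (weave (@tag _ _) (@tag _ _) (@brace_graft R P _)).
Notation eweave := (weave (@tag _ _) (@tag _ _) (@eval_graft R A _)).

(** All components of [brace_of_brace_component] at once; evaluation at one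
    component is linear, so it passes through [weave]. *)
Lemma brace_of_brace x ys zs e :
  brace (hel (brace x ys (tag x + total_degree ys))) zs e
  = bweave ys zs (fun l => brace x l e).
Proof.
apply: functional_extensionality_dep => T; rewrite (brace_of_brace_component laws).
rewrite -[ys in RHS]map_id.
apply/esym/(@weave_map _ _ _ _ _ _ id (fun x : A e => x T)) => //.
Qed.

Lemma bweave_nil (V : lmodType R) zs (k : seq (helt A) -> V) : bweave zs [::] k = k zs.
Proof.
elim: zs k => [|z zs IH] k //; rewrite weave_cons_nil /weave_here big_ord_recl big_ord0 addr0.
rewrite {2}/degree_sum big_nil pairing0r scale1r /brace_graft IH.
have -> : tag z + @total_degree R A [::] = tag z by rewrite /total_degree big_nil addr0.
by case: z => d z; rewrite /brace component_id.
Qed.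

(** At any zs, both sides are the same [weave]. *)
Lemma brace_Phi' x ys e n :
  brace (Phi' x) (map Phi' ys) e n = brace_map (brace x ys e) n.
Proof.
have [->|ne] := eqVneq e (tag x + total_degree ys); last first.
  rewrite !brace_supp ?total_degree_Phi' //.
  by rewrite (lin_zero (@brace_map_linear e n)).
apply: mmapP => zs c; have [sz|sz] := eqVneq (size zs) n; last first.
  by rewrite !mval_supp // (negbTE sz).
rewrite brace_mapE // brace_of_brace (endo_braceE _ sz) ?total_degree_Phi' //.
rewrite (@weave_map _ _ _ _ _ _ Phi' id (@tag _ _) _ _ (@brace_graft R P _)) // => [|G t j].
  by apply: weave_ext => l _; rewrite brace_mapE //; case: (x).
by rewrite /eval_graft /brace_graft brace_mapE //; case: (G).
Qed.

(** * The structure maps and Phi' *)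
Variables (d : bidegree) (mu : A d).

(** What must be subtracted from Phi' mu to obtain the structure maps. *)
Definition correction (n : nat) : endo A n d :=
  match n with
  | 0 => brace_map mu 0
  | 1 => right_brace_map mu
  | _ => 0
  end.

Definition structure_sum : total (endo A) d := brace_structure mu.

Lemma structure_sumE :
  structure_sum = (-1) *: (correction : total (endo A) d) + (brace_map mu : total (endo A) d).
Proof.
apply: functional_extensionality_dep => -[|[|n]].
- by rewrite /structure_sum /= scaleN1r; apply/esym; exact: addNr.
- by rewrite /structure_sum /= scaleN1r addrC.
- by rewrite /structure_sum /= scaleN1r; apply/esym; rewrite -[RHS]add0r; congr (_ + _); exact: oppr0.
Qed.

Lemma hel_component (x : helt A) e : e = tag x -> hel (component e x) = x.
Proof. by case: x => c x /= ->; rewrite component_id. Qed.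

Notation G := (@hel _ _ (total (endo A)) d correction).

Lemma eval_correction0 (V : lmodType R) (k : helt A -> V) : eval_graft G [::] k = k (hel mu).
Proof.
congr k; apply: (hel_component (x := hel mu)).
by rewrite /total_degree big_nil addr0.
Qed.

Lemma eval_correction1 (V : lmodType R) z (k : helt A -> V) :
  eval_graft G [:: z] k
  = k (hel (sgn (pairing d (tag z)) *: brace z [:: hel mu] (tag z + total_degree [:: hel mu]))).
Proof.
rewrite /eval_graft /= (_ : d + total_degree [:: z] = tag z + total_degree [:: hel mu]) //.
by rewrite /total_degree !big_seq1 addrC.
Qed.

Lemma eval_correction2 (V : lmodType R) t (k : helt A -> V) : (1 < size t)%N ->
  eval_graft G t k = k (hel (0 : A (d + total_degree t))).
Proof. by case: t => [|z [|z' t]]. Qed.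

(** Both sides sum the values of k on the lists with mu inserted among the zs,
    which the arity 0 part of [correction] produces, and on those with some z
    replaced by b_1(z; mu), which its arity 1 part produces. On the left mu comes
    after the zs and passes those to its right; the factor sgn <mu, zs> turns this into the
    sign for passing those to its left. *)
Lemma weave_correction (V : lmodType R) zs (k : seq (helt A) -> V) :
  (forall s t c a (x y : A c),
     k (s ++ hel (a *: x + y) :: t) = a *: k (s ++ hel x :: t) + k (s ++ hel y :: t)) ->
  sgn (pairing d (total_degree zs)) *: bweave zs [:: hel mu] k = eweave [:: G] zs k.
Proof.
elim: zs k => [|z zs IH] k link.
  rewrite [LHS]/= weave_cons_nil /weave_here big_ord_recl big_ord0 addr0 eval_correction0.
  by rewrite /= {2}/degree_sum big_nil pairing0r /total_degree big_nil pairing0r.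
have link0 c t : k (hel (0 : A c) :: t) = 0 := lin_zero (link [::] t c).
have linkZ c t a (x : A c) : k (hel (a *: x) :: t) = a *: k (hel x :: t).
  exact: (lin_scale (link [::] t c)).
rewrite !weave_cons bweave_nil /weave_here.
rewrite [X in _ *: (_ + X)]big_ord_recl big_ord_recl big_ord0 addr0.
rewrite [X in _ = _ + X]big_ord_recl [X in _ = _ + (_ + X)]big_ord_recl.
rewrite [X in _ = _ + (_ + (_ + X))]big1 => [|a _]; last first.
  rewrite eval_correction2; last by rewrite size_take; case: ifP => //= _; case: (zs) a => [[]|].
  by rewrite /= link0 scaler0.
rewrite addr0 !lift0 take0 !drop0 eval_correction0 /= take0 drop0 eval_correction1 linkZ.
rewrite -[X in _ = sgn _ *: X + _]/(eweave [:: G] zs (fun l => k (z :: l))) -IH; last first.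
  by move=> s t c a x y; exact: (link (z :: s)).
have -> : brace_graft z [::] (fun v => bweave zs [:: hel mu] (fun l => k (v :: l)))
    = bweave zs [:: hel mu] (fun l => k (z :: l)).
  by rewrite /brace_graft hel_component // /total_degree big_nil addr0.
rewrite /brace_graft bweave_nil total_degree_cons /degree_sum !big_nil big_seq1 !addr0 !pairing0r !pairing0l.
rewrite !scale1r !scalerDr !scalerA -!sgnD -pairingDr.
rewrite -[\sum_(x <- zs) tag x]/(total_degree zs) -[tag (hel mu)]/d ![pairing _ d]pairingC.
rewrite sgnD sgn_sqr scale1r addrCA pairingDr; congr (_ + (_ + _ *: _)).
exact: (@eq_sgn _ _ _ (pairing d (total_degree zs))).
Qed.

(** On the left only the arity 1 part of [correction] acts, on all of b(y; zs),
    so that the value is b_1(b(y; zs); mu) up to sign; expand it by the brace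
    relation and compare by [weave_correction]. *)
Lemma brace_correction_commute y n e :
  brace G [:: Phi' y] e n = sgn (pairing d (tag y)) *: brace (Phi' y) [:: G] e n.
Proof.
have [->|ne] := eqVneq e (d + tag y); last first.
  by rewrite !brace_supp ?scaler0 // /total_degree big_seq1 // addrC.
apply: mmapP => zs c; have [sz|sz] := eqVneq (size zs) n; last first.
  by rewrite !mval_supp // (negbTE sz).
rewrite [RHS]/= !(endo_braceE _ sz) ?/total_degree ?big_seq1 //; last exact: addrC.
rewrite weave_single //; last by case=> [|? [|? ?]].
case: y => b y.
have -> : eweave [:: G] zs (fun l => (tagged (Phi' (hel y)) (size l) : mmap A _ _) l c)
    = eweave [:: G] zs (fun l => brace (hel y) l c).
  by apply: weave_ext => l _; rewrite brace_mapE.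
rewrite -weave_correction => [|s t b' a x z]; last exact: brace_linr.
rewrite /eval_graft brace_mapE // scalerA -sgnD -pairingDr.
by rewrite -(brace_of_brace (hel y) zs [:: hel mu]).
Qed.

Lemma brace_correction_eq0 ys n e : (1 < size ys)%N -> brace G (map Phi' ys) e n = 0.
Proof.
move=> sy; have [Ee|ne] := eqVneq e (d + total_degree (map Phi' ys)); last by rewrite brace_supp.
apply: mmapP => zs c; have [sz|sz] := eqVneq (size zs) n; last first.
  by rewrite !mval_supp // (negbTE sz).
rewrite (endo_braceE _ sz) // weave_eq0 // => l; rewrite size_map => sl.
by move/(leq_trans sy): sl; case: l => [|? [|? ?]].
Qed.

(** For j = 1 the commutators of Phi' y with the structure and with Phi' mu are
    equal, since the two contributions of [correction] cancel. *)
Lemma brace_structure_Phi' j ys e n : (0 < j)%N -> size ys = j ->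
  brace_structure structure_sum j (map Phi' ys) e n = brace_map (brace_structure mu j ys e) n.
Proof.
have braceS ys' : brace (hel structure_sum) (map Phi' ys') e n
    = - brace G (map Phi' ys') e n + brace_map (brace (hel mu) ys' e) n.
  rewrite structure_sumE brace_linl -brace_Phi' -scaleN1r; congr (_ + _).
case: j => [|[|j]] // _ sy.
  case: ys sy => [|y [|]] // _.
  set s : R := sgn (pairing d (tag y)).
  transitivity (brace (hel structure_sum) (map Phi' [:: y]) e n
      - s *: brace (Phi' y) [:: hel structure_sum] e n); first by [].
  transitivity (brace_map (brace (hel mu) [:: y] e - s *: brace y [:: hel mu] e) n); last by [].
  have structR : brace (Phi' y) [:: hel structure_sum] e n
      = - brace (Phi' y) [:: G] e n + brace_map (brace y [:: hel mu] e) n.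
    rewrite structure_sumE -(brace_Phi' y [:: hel mu]) -scaleN1r.
    by rewrite (brace_linr (Phi' y) [::] [::] (-1)).
  rewrite braceS structR brace_correction_commute scalerDr scalerN opprD opprK addrACA addNr add0r.
  have lin := @brace_map_linear e n.
  by rewrite (lin_add lin) -[in RHS]scaleNr (lin_scale lin) scaleNr.
transitivity (brace (hel structure_sum) (map Phi' ys) e n).
  by congr (_ n); apply: brace_mapE; rewrite size_map.
transitivity (brace_map (brace (hel mu) ys e) n); last first.
  by congr (brace_map _ n); apply/esym/brace_mapE.
by rewrite braceS brace_correction_eq0 ?sy // oppr0 add0r.
Qed.

End PhiPrime.

(** * Back to the shifted structures *)
Section ShiftedStructure.
Variables (R : comPzRingType) (P : operad_data R).
Hypothesis laws : operad_laws P.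
Local Notation A := (total P).
Local Notation sigma := (@sigma_bar R A).
Local Notation osigma := (total_map sigma).

Lemma brace_structure_sigma d (F : total (endo A) d) j Gs e n : (0 < j)%N -> size Gs = j ->
  brace_structure (fun k => sigma (F k) : susp (endo (shift A)) k d) j (map osigma Gs) e n
  = sigma (brace_structure F j Gs e n).
Proof.
case: j => [|[|j]] // _ sG.
  case: Gs sG => [|y [|]] // _; set s : R := sgn (pairing d (tag y)).
  transitivity (brace (osigma (hel F)) (map osigma [:: y]) e n
      - s *: brace (osigma y) (map osigma [:: hel F]) e n); first by [].
  transitivity (sigma (brace (hel F) [:: y] e n - s *: brace y [:: hel F] e n)); last by [].
  have lin := @sigma_bar_linear _ A n e.
  by rewrite !brace_sigma (lin_add lin) -[in RHS]scaleNr (lin_scale lin) scaleNr.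
transitivity (brace (osigma (hel F)) (map osigma Gs) e n).
  by congr (_ n); apply: brace_mapE; rewrite size_map.
rewrite brace_sigma; congr (sigma (_ n)).
by apply/esym/brace_mapE.
Qed.

Lemma shift_exponent_tag (B C : bigraded R) (f : helt B -> helt C) xs :
  (forall x, tag (f x) = tag x) -> shift_exponent (map f xs) = shift_exponent xs.
Proof. by move=> tagf; elim: xs => //= x xs ->; rewrite size_map tagf. Qed.

End ShiftedStructure.

Theorem theoremC (R : comPzRingType) (O : operad R) (m : mult_family O)
    (O_bounded : horizontally_bounded_right O)
    (m_mult : derived_Ainf_multiplication m) :
  derived_Ainf_morphism (M m) (Mbar m) (@Phi R (susp O)).
Proof.
have laws := susp_laws (operadP O); pose sigma := @sigma_bar R (total (susp O)).
split=> [d a x y|i j j0 xs sx e]; apply: functional_extensionality_dep => n.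
  rewrite /Phi (@brace_map_linear _ _ (d - bideg 0 1)).
  exact: (@sigma_bar_linear _ _ n (d - bideg 0 1)).
pose ys := map (@unshift _ _) xs; pose mu := mult_sum m i.
have sy : size ys = j by rewrite size_map.
pose zs := map (total_map sigma) (map (@Phi' _ _) ys).
have Ezs : map (@unshift _ _) [seq hel (Phi (tagged x)) | x <- xs] = zs.
  by rewrite /zs /ys -!map_comp.
transitivity (sigma n _ (brace_map (sgn (shift_exponent ys) *:
    (brace_structure mu j : mmap _ _ _) ys (e - bideg 0 1)) n)); first by [].
transitivity (sgn (shift_exponent zs) *:
    (brace_structure (M_sum m i) j : mmap _ _ _) zs (e - bideg 0 1) n); last by rewrite -Ezs.
rewrite (lin_scale (@brace_map_linear _ _ (e - bideg 0 1) n)).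
rewrite /sigma (lin_scale (@sigma_bar_linear _ _ n (e - bideg 0 1))).
have -> : shift_exponent zs = shift_exponent ys.
  by rewrite (@shift_exponent_tag _ _ _ (total_map sigma)) // (@shift_exponent_tag _ _ _ (@Phi' _ _)).
congr (_ *: _).
rewrite -(brace_structure_Phi' laws) // -brace_structure_sigma ?size_map //.
Qed.
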